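(* Let $P$ be a probability distribution on $\mathcal{X}=\mathbb{F}_d^2$ and let $\mathcal{A}\sim\{\sqrt{P(u)}\,N_u\}_{u\in\mathcal{X}}$ be the corresponding Pauli channel. Then $$\mathsf{C}(\mathcal{A})\ \ge\ \sup_{n\ge 1}\ \max_{\mathcal{C}\in\mathsf{S}_n(\mathcal{N})}\ \frac{I_{\rm c}\big((\dim\mathcal{C})^{-1}\Pi_{\mathcal{C}},\ \mathcal{A}^{\otimes n}\big)}{n},$$ where $\Pi_{\mathcal{C}}$ is the orthogonal projection onto $\mathcal{C}$.
   Context: Let $d$ be a prime, $\mathbb{F}=\mathbb{F}_d=\mathbb{Z}/d\mathbb{Z}$, and $\mathcal{H}$ a Hilbert space of dimension $d$ with a fixed orthonormal basis $\{|0\rangle,\dots,|d-1\rangle\}$. Let $\omega$ be a primitive $d$-th root of unity and define unitaries $X|j\rangle=|(j-1)\bmod d\rangle$, $Z|j\rangle=\omega^j|j\rangle$. Put $\mathcal{X}=\mathbb{F}^2$, $N_{(i,j)}=X^iZ^j$ for $(i,j)\in\mathcal{X}$, and $\mathcal{N}=\{N_u\}_{u\in\mathcal{X}}$. For $x=((u_1,v_1),\dots,(u_n,v_n))\in\mathcal{X}^n$, identified with $(u_1,v_1,\dots,u_n,v_n)\in\mathbb{F}^{2n}$, put $N_x=N_{(u_1,v_1)}\otimes\cdots\otimes N_{(u_n,v_n)}$. The symplectic form on $\mathbb{F}^{2n}$ is $\langle x,y\rangle=\sum_{i=1}^n(u_iv_i'-v_iu_i')$ for $y=(u_1',v_1',\dots,u_n',v_n')$;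 for a subspace $L$, $L^\perp=\{y:\langle x,y\rangle=0\ \forall x\in L\}$, and $L$ is self-orthogonal if $L\subset L^\perp$. For a self-orthogonal $L\subset\mathbb{F}^{2n}$ with $\dim L=n-k$ ($0\le k\le n$), a symplectic stabilizer code with stabilizer $N_L=\{N_x:x\in L\}$ is a $d^k$-dimensional subspace of $\mathcal{H}^{\otimes n}$ of the form $\{\psi:\ N_x\psi=\tau(x)\psi\ \forall x\in L\}$ for some scalars $\tau(x)$. $\mathsf{S}_n(\mathcal{N})$ is the set of all such codes (over all such $L$ and $k$). For a probability distribution $P$ on $\mathcal{X}$, the channel $\mathcal{A}\sim\{\sqrt{P(u)}N_u\}$ is the map $\rho\mapsto\sum_uP(u)N_u\rho N_u^\dagger$ on operators on $\mathcal{H}$; $\mathcal{A}^{\otimes n}(\rho)=\sum_{x\in\mathcal{X}^n}P^n(x)N_x\rho N_x^\dagger$ with $P^n(x)=\prod_iP(x_i)$. A code is a pair $(\mathcal{C},\mathcal{R})$ with $\mathcal{C}\subset\mathcal{H}^{\otimes n}$ a subspace and $\mathcal{R}$ a trace-preserving completely positive map on operators on $\mathcal{H}^{\otimes n}$; its minimum fidelity is $F(\mathcal{C},\mathcal{R}\mathcal{A}^{\otimes n})=\min_{\text{unit }\psi\in\mathcal{C}}\langle\psi|\mathcal{R}(\mathcal{A}^{\otimes n}(|\psi\rangle\langle\psi|))|\psi\rangle$. For an integer $n\ge1$ and real $0\le k\le n$, $F^\star_{n,k}(\mathcal{A}^{\otimes n})$ is the supremum of this fidelity over codes with $\log_d\dim\mathcal{C}\ge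 k$. The quantum capacity $\mathsf{C}(\mathcal{A})$ is the supremum of $R\ge0$ with $\limsup_{n\to\infty}F^\star_{n,Rn}(\mathcal{A}^{\otimes n})=1$. The coherent information is $I_{\rm c}(\rho,\mathcal{A}')=S(\mathcal{A}'(\rho))-S(({\rm I}\otimes\mathcal{A}')(|\Psi\rangle\langle\Psi|))$, where $S$ is von Neumann entropy with logarithm to base $d$, ${\rm I}$ is the identity map, and $|\Psi\rangle$ is a purification of $\rho$. *)

(* Defs.v *)
From HB Require Import structures.
From mathcomp Require Import all_boot all_order all_algebra.
From mathcomp Require Import all_classical all_reals.
From mathcomp Require Import ereal exp sequences.
From mathcomp Require Import complex.
From Stdlib Require Import ClassicalEpsilon.

Set Implicit Arguments.
Unset Strict Implicit.
Unset Printing Implicit Defensive.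

Import Order.TTheory GRing.Theory Num.Theory.
Local Open Scope ring_scope.

Section PauliCapacity.

Variable R : realType.
Local Notation C := (complex.complex R).

Definition toC (r : R) : C := complex.Complex r 0.

Definition adj m n (A : 'M[C]_(m, n)) : 'M[C]_(n, m) := (map_mx Num.conj A)^T.

(* Operators on a Hilbert space with fixed orthonormal basis indexed by a
   finite type T (|t>, t : T), as #|T| x #|T| matrices; vectors are columns. *)
Definition op (T : finType) := 'M[C]_#|T|.
Definition vec (T : finType) := 'cV[C]_#|T|.
Definition ent (T : finType) (A : op T) (i j : T) : C :=
  A (enum_rank i) (enum_rank j).
Definition mkop (T : finType) (f : T -> T -> C) : op T :=
  \matrix_(i, j) f (enum_val i) (enum_val j).

Definition kraus (I T : finType) (K : I -> op T) (rho : op T) : op T :=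
  \sum_(i : I) (K i *m rho *m adj (K i)).

Definition trace_preserving (I T : finType) (K : I -> op T) : Prop :=
  \sum_(i : I) (adj (K i) *m K i) = 1%:M.

(* 1 (x) K on (reference system) (x) (system), reference basis indexed by T *)
Definition liftR (T : finType) (K : op T) : op (T * T)%type :=
  mkop (fun a b : (T * T)%type => (a.1 == b.1)%:R * ent K a.2 b.2).

Definition ptrR (T : finType) (M : op (T * T)%type) : op T :=
  mkop (fun i j => \sum_(r : T) ent M (r, i) (r, j)).

Definition purif (T : finType) (rho : op T) : vec (T * T)%type :=
  epsilon (inhabits 0) (fun Psi : vec (T * T)%type => ptrR (Psi *m adj Psi) = rho).

Variable d : nat.

(* von Neumann entropy with logarithm to base d, computed from the eigenvalues
   (roots of the characteristic polynomial, with multiplicity). *)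
Definition etaf (x : R) : R := if 0 < x then - (x * ln x / ln d%:R) else 0.
Definition vN_entropy (T : finType) (rho : op T) : R :=
  \sum_(z <- sval (closed_field_poly_normal (char_poly rho))) etaf (complex.Re z).

Definition coh_info (I T : finType) (K : I -> op T) (rho : op T) : R :=
  vN_entropy (kraus K rho)
  - vN_entropy (kraus (fun i => liftR (K i)) (purif rho *m adj (purif rho))).

Definition is_orth_proj (T : finType) (Cs : {vspace vec T}) (Pi : op T) : Prop :=
  adj Pi = Pi /\ (forall v : vec T, Pi *m v \in Cs) /\
  (forall v : vec T, v \in Cs -> Pi *m v = v).
Definition orth_proj (T : finType) (Cs : {vspace vec T}) : op T :=
  epsilon (inhabits 0) (is_orth_proj Cs).

Variable omega : C.

(* single qudit: X|j> = |j-1 mod d>, Z|j> = omega^j |j> *)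
Definition Xop : 'M[C]_d := \matrix_(a, b) ((a : nat) == (((b : nat) + d.-1) %% d)%N)%:R.
Definition Zop : 'M[C]_d := \matrix_(a, b) ((a == b)%:R * omega ^+ (b : nat)).
Definition Nu (u : 'F_d * 'F_d) : 'M[C]_d := Xop ^+ (u.1 : nat) *m Zop ^+ (u.2 : nat).

(* n qudits: basis indexed by functions 'I_n -> 'I_d *)
Definition qidx (n : nat) := {ffun 'I_n -> 'I_d}.

(* x in X^n = (F_d^2)^n, stored as an n x 2 matrix: row i = (u_i, v_i);
   identified with (u_1, v_1, ..., u_n, v_n) in F_d^(2n). *)
Definition Nx n (x : 'M['F_d]_(n, 2)) : op (qidx n) :=
  mkop (fun i j : qidx n => \prod_(k < n) Nu (x k 0, x k 1) (i k) (j k)).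

Definition symp n (x y : 'M['F_d]_(n, 2)) : 'F_d :=
  \sum_(i < n) (x i 0 * y i 1 - x i 1 * y i 0).

Definition stabilizer_code n (Cs : {vspace vec (qidx n)}) : Prop :=
  exists (L : {vspace 'M['F_d]_(n, 2)}) (k : nat),
    [/\ (k <= n)%N,
        (forall x y, x \in L -> y \in L -> symp x y = 0),
        \dim L = (n - k)%N &
        exists tau : 'M['F_d]_(n, 2) -> C,
          (forall psi : vec (qidx n),
              psi \in Cs <-> (forall x, x \in L -> Nx x *m psi = tau x *: psi))
          /\ \dim Cs = (d ^ k)%N].

Variable P : 'F_d * 'F_d -> R.

Definition Pn n (x : 'M['F_d]_(n, 2)) : R := \prod_(k < n) P (x k 0, x k 1).

(* Kraus operators of A^{(x) n}: sqrt(P^n(x)) N_x *)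
Definition chanK n (x : 'M['F_d]_(n, 2)) : op (qidx n) :=
  toC (Num.sqrt (Pn x)) *: Nx x.

Definition min_fidelity n (Cs : {vspace vec (qidx n)}) (m : nat)
    (Rk : 'I_m -> op (qidx n)) : R :=
  inf [set complex.Re ((adj psi *m kraus Rk (kraus (@chanK n) (psi *m adj psi)) *m psi) 0 0)
      | psi in [set psi : vec (qidx n) | psi \in Cs /\ (adj psi *m psi) 0 0 = 1]].

(* F*_{n,k}: supremum over codes (C, R), R trace-preserving completely
   positive (Kraus form), with log_d dim C >= k *)
Definition Fstar n (k : R) : \bar R :=
  ereal_sup [set f : \bar R | exists (Cs : {vspace vec (qidx n)}) (m : nat)
                                      (Rk : 'I_m -> op (qidx n)),
     [/\ powR (d%:R) k <= (\dim Cs)%:R, trace_preserving Rk &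
         f = (min_fidelity Cs Rk)%:E]].

(* quantum capacity C(A): sup of rates R >= 0 with limsup_n F*_{n,Rn} = 1
   (sequence indexed by n >= 1, written n.+1) *)
Definition capacity : \bar R :=
  ereal_sup [set r%:E | r in [set r : R | 0 <= r /\
     limn_esup (fun n => Fstar n.+1 (r * n.+1%:R)) = 1%E]].

End PauliCapacity.

(* Main.v *)
Require Import Defs.
From HB Require Import structures.
From mathcomp Require Import all_boot all_order all_algebra all_field.
From mathcomp Require Import all_classical all_reals.
From mathcomp Require Import ereal exp sequences.
From mathcomp Require Import complex spectral.
From mathcomp Require Import ring lra zify.
Import Order.TTheory GRing.Theory Num.Theory.
Local Open Scope ring_scope.
Set Implicit Arguments.
Unset Strict Implicit.
Unset Printing Implicit Defensive.

(* Let L be the stabilizer of the inner code C, |L| = d^(n-k), and write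
   p = P^n, q(x) = p(x + L) and g(x) = p(x + L^perp).  The Pauli operators N_x
   move C to orthogonal or equal subspaces according to x mod L^perp, and a
   purification of the normalised projection onto C to orthogonal or equal
   vectors according to x mod L; hence the coherent information is
   k - sum_x p(x) log_d (g(x) / q(x)).

   For m blocks let M be the m-fold power of L.  Extend M to an isotropic
   L' one vector y at a time, with y in L'^perp \ L'.  On average over y, an
   error difference z in L'^perp \ L' survives in the next L'^perp with
   probability at most 1/d, so some y divides by d the expected number of
   undetected typical competitors of the actual error.  There are initially at
   most d^t of them up to translation by M if an error is called typical when
   its coset modulo M has conditional probability at least d^-t given its
   syndrome, and a Chernoff bound shows that typical errors have probability
   tending to 1 as soon as t / m exceeds sum_x p(x) log_d (g(x) / q(x)).
   Decoding to a typical error with the observed syndrome then gives every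
   rate below the normalised coherent information, along the lengths m n. *)

(** * Pauli operators *)

Section Operators.
Variable R : realType.
Local Notation C := (R[i]).
Implicit Types T : finType.

Lemma hadjM m n p (A : 'M[C]_(m, n)) (B : 'M[C]_(n, p)) :
  adj (A *m B) = adj B *m adj A.
Proof. by rewrite /adj map_mxM trmx_mul. Qed.

Lemma hadjK m n (A : 'M[C]_(m, n)) : adj (adj A) = A.
Proof. by apply/matrixP => i j; rewrite !mxE conjCK. Qed.

Lemma hadjD m n (A B : 'M[C]_(m, n)) : adj (A + B) = adj A + adj B.
Proof. by apply/matrixP => i j; rewrite !mxE rmorphD. Qed.

Lemma hadjZ m n a (A : 'M[C]_(m, n)) : adj (a *: A) = a^* *: adj A.
Proof. by apply/matrixP => i j; rewrite !mxE rmorphM. Qed.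

Lemma hadj_sum m n (I : finType) (Q : pred I) (A : I -> 'M[C]_(m, n)) :
  adj (\sum_(i | Q i) A i) = \sum_(i | Q i) adj (A i).
Proof.
apply: (big_morph (@adj R m n)); first exact: hadjD.
by apply/matrixP => i j; rewrite !mxE rmorph0.
Qed.

Lemma entK T (A : op R T) : mkop (ent A) = A.
Proof. by apply/matrixP => i j; rewrite mxE /ent !enum_valK. Qed.

Lemma ent_mkop T (f : T -> T -> C) i j : ent (mkop f) i j = f i j.
Proof. by rewrite /ent mxE !enum_rankK. Qed.

Lemma eq_mkop T (f g : T -> T -> C) : (forall i j, f i j = g i j) -> mkop f = mkop g.
Proof. by move=> fg; apply/matrixP => i j; rewrite !mxE. Qed.

Lemma sum_enum_val T (f : T -> C) : \sum_(k < #|T|) f (enum_val k) = \sum_k f k.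
Proof. by rewrite [RHS](reindex (@enum_val T predT)) //; apply: onW_bij; exact: enum_val_bij. Qed.

Lemma mkopM T (f g : T -> T -> C) :
  mkop f *m mkop g = mkop (fun i j => \sum_k f i k * g k j).
Proof.
apply/matrixP => i j; rewrite !mxE -[RHS]sum_enum_val; apply: eq_bigr => k _.
by rewrite !mxE.
Qed.

Lemma mkop_adj T (f : T -> T -> C) : adj (mkop f) = mkop (fun i j => (f j i)^*).
Proof. by apply/matrixP => i j; rewrite !mxE. Qed.

Lemma mkop1 T : mkop (fun i j : T => (i == j)%:R : C) = 1%:M.
Proof. by apply/matrixP => i j; rewrite !mxE (inj_eq enum_val_inj). Qed.

Lemma mkop_tr T (f : T -> T -> C) : \tr (mkop f) = \sum_i f i i.
Proof. by rewrite -[RHS]sum_enum_val; apply: eq_bigr => k _; rewrite !mxE. Qed.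

Lemma mkopZ T a (f : T -> T -> C) : mkop (fun i j => a * f i j) = a *: mkop f.
Proof. by apply/matrixP => i j; rewrite !mxE. Qed.

End Operators.

Section Pauli.
Variables (R : realType) (d : nat) (omega : R[i]).
Hypothesis d_prime : prime d.
Hypothesis omega_prim : d.-primitive_root omega.
Local Notation C := (R[i]).

Let d_gt0 : (0 < d)%N := prime_gt0 d_prime.

Let d_char : d \in [pchar 'F_d] := pchar_Fp d_prime.

(** The additive character of ['F_d] attached to [omega]; the phases in products of Pauli operators
    are values of it. *)
Definition chi (a : 'F_d) : C := omega ^+ (a : nat).

Lemma chi_nat k : chi k%:R = omega ^+ k.
Proof. by rewrite /chi val_Fp_nat // (prim_expr_mod omega_prim). Qed.

Lemma chi0 : chi 0 = 1.
Proof. by []. Qed.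

Lemma chiD a b : chi (a + b) = chi a * chi b.
Proof.
by rewrite -{1}[a]natr_Zp -{1}[b]natr_Zp -natrD chi_nat exprD.
Qed.

Lemma chi_sum (I : finType) (Q : pred I) (f : I -> 'F_d) :
  chi (\sum_(i | Q i) f i) = \prod_(i | Q i) chi (f i).
Proof. exact: (big_morph chi chiD chi0). Qed.

Lemma chiNM a : chi (- a) * chi a = 1.
Proof. by rewrite -chiD addNr. Qed.

Lemma chi_neq0 a : chi a != 0.
Proof. by apply/eqP => h; have := chiNM a; rewrite h mulr0 => /eqP; rewrite eq_sym oner_eq0. Qed.

Lemma chi_conj a : (chi a)^* = chi (- a).
Proof.
have w1 : `|omega| = 1.
  have := prim_expr_order omega_prim => /(congr1 Num.norm).
  by rewrite normrX normr1 => /eqP; rewrite pexpr_eq1 // => /eqP.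
have n1 : `|chi a| = 1 by rewrite /chi normrX w1 expr1n.
apply: (mulIf (chi_neq0 a)); rewrite chiNM mulrC.
by have := normCK (chi a); rewrite n1 expr1n => <-.
Qed.

Lemma chi_eq1 a : chi a = 1 -> a = 0.
Proof.
move=> /eqP; rewrite /chi -(prim_order_dvd omega_prim) => /dvdnP [q aq].
by rewrite -[a]natr_Zp aq natrM (_ : d%:R = 0) ?mulr0 // -[X in X%:R = _]/d; apply/eqP;
   rewrite -(dvdn_pcharf (d_char)).
Qed.

(** The bound of the ordinal type ['F_d] equals [d] only because [d] is prime. These casts carry
    basis labels to the field, where shifts modulo [d] become additions. *)
Definition toF (a : 'I_d) : 'F_d := (a : nat)%:R.
Definition ofF (a : 'F_d) : 'I_d := cast_ord (Fp_cast d_prime) a.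

Lemma toFK : cancel toF ofF.
Proof. by move=> a; apply/val_inj; rewrite /= val_Fp_nat // modn_small. Qed.

Lemma ofFK : cancel ofF toF.
Proof. by move=> a; rewrite /toF /= natr_Zp. Qed.

Lemma sum_toF (f : 'F_d -> C) : \sum_(a < d) f (toF a) = \sum_a f a.
Proof.
rewrite (reindex ofF) /=; last by exists toF => a _; [exact: ofFK | exact: toFK].
by apply: eq_bigr => a _; rewrite ofFK.
Qed.

Lemma toF_eq a b : (toF a == toF b) = (a == b).
Proof. exact: (inj_eq (can_inj toFK)). Qed.

Lemma XopX u (a b : 'I_d) : (Xop R d ^+ u) a b = (toF b == toF a + u%:R)%:R.
Proof.
elim: u a b => [|u IH] a b; first by rewrite expr0 mxE addr0 toF_eq eq_sym.
rewrite exprS mxE.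
transitivity (\sum_c (toF c == toF a + 1)%:R * (toF b == toF c + u%:R)%:R : C).
  apply: eq_bigr => c _; rewrite IH mxE; congr (_%:R * _).
  congr nat_of_bool; rewrite -[LHS]/(_ == _).
  (* [Xop] encodes the lowering shift as adding [d.-1], which is -1 in ['F_d]. *)
  have -> : (toF c == toF a + 1) = (toF a == toF c + d.-1%:R).
    rewrite -subr_eq eq_sym; congr (_ == _ + _).
    apply/eqP; rewrite eq_sym -subr_eq0 opprK natr1 prednK //.
    by rewrite -(dvdn_pcharf (d_char)).
  rewrite /toF -natrD; apply/eqP/eqP => [->|/(congr1 val)].
    by apply/val_inj; rewrite /= !val_Fp_nat // modn_mod.
  by rewrite /= !val_Fp_nat // modn_small.
rewrite (sum_toF (fun c => (c == toF a + 1)%:R * (toF b == c + u%:R)%:R)).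
rewrite (bigD1 (toF a + 1)) //= eqxx mul1r big1 ?addr0 => [|c /negPf ->]; last by rewrite mul0r.
by rewrite -natr1 -addrA [1 + _]addrC.
Qed.

Lemma ZopX v (a b : 'I_d) :
  (Zop d omega ^+ v) a b = (a == b)%:R * omega ^+ (b * v)%N.
Proof.
elim: v a b => [|v IH] a b; first by rewrite expr0 mxE muln0 mulr1.
rewrite exprS mxE (bigD1 a) //= big1 ?addr0 => [|c /negPf ca]; last first.
  by rewrite mxE [a == c]eq_sym ca !mul0r.
rewrite IH mxE eqxx mul1r; case: eqP => [->|]; last by rewrite !mul0r mulr0.
by rewrite !mul1r -exprD mulnS.
Qed.

Lemma NuE u (a b : 'I_d) :
  Nu omega u a b = (toF b == toF a + u.1)%:R * chi (toF b * u.2).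
Proof.
rewrite /Nu mxE (bigD1 b) //= big1 ?addr0 => [|c /negPf cb]; last first.
  by rewrite ZopX cb mul0r mulr0.
rewrite XopX ZopX eqxx mul1r natr_Zp -chi_nat natrM natr_Zp.
by [].
Qed.

(** The phase comes from moving [Z^u.2] past [X^v.1]: one has [Z X = omega^-1 X Z], since [X] lowers
    the basis label. *)
Lemma NuM (u v : 'F_d * 'F_d) :
  Nu omega u *m Nu omega v = chi (- (u.2 * v.1)) *: Nu omega (u + v).
Proof.
apply/matrixP => a b; rewrite [LHS]mxE [RHS]mxE NuE /=.
transitivity (\sum_c ((toF c == toF a + u.1)%:R * chi (toF c * u.2)) *
   ((toF b == toF c + v.1)%:R * chi (toF b * v.2)) : C).
  by apply: eq_bigr => c _; rewrite !NuE.
rewrite (sum_toF (fun c => ((c == toF a + u.1)%:R * chi (c * u.2)) *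
   ((toF b == c + v.1)%:R * chi (toF b * v.2)))).
rewrite (bigD1 (toF a + u.1)) //= eqxx mul1r big1 ?addr0 => [|c /negPf ->]; last by rewrite !mul0r.
rewrite addrA; case: eqP => [->|_]; last by rewrite !mul0r !mulr0.
rewrite !mul1r -!chiD; congr chi; ring.
Qed.

Lemma Nu0 : Nu omega (0 : 'F_d * 'F_d) = 1%:M.
Proof. by rewrite /Nu /= !expr0 mul1mx. Qed.

Lemma Nu_unitary (u : 'F_d * 'F_d) : adj (Nu omega u) *m Nu omega u = 1%:M.
Proof.
apply/matrixP => a b; rewrite mxE mxE.
transitivity (\sum_c ((toF a == toF c + u.1)%:R * chi (- (toF a * u.2))) *
   ((toF b == toF c + u.1)%:R * chi (toF b * u.2)) : C).
  by apply: eq_bigr => c _; rewrite [X in X * _]mxE [X in X * _]mxE !NuE rmorphM rmorph_nat /= chi_conj.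
rewrite (sum_toF (fun c => ((toF a == c + u.1)%:R * chi (- (toF a * u.2))) *
   ((toF b == c + u.1)%:R * chi (toF b * u.2)))).
rewrite (bigD1 (toF a - u.1)) //= subrK eqxx mul1r big1 ?addr0 => [|c]; last first.
  by rewrite eq_sym subr_eq => /negPf ->; rewrite !mul0r.
rewrite toF_eq eq_sym; case: eqP => [->|_]; last by rewrite mul0r mulr0.
by rewrite mul1r chiNM.
Qed.

Lemma Nu_tr (u : 'F_d * 'F_d) : \tr (Nu omega u) = (u == 0)%:R * d%:R.
Proof.
have [->|u0] := eqVneq u 0; first by rewrite Nu0 mxtrace1 mul1r.
transitivity (\sum_b (toF b == toF b + u.1)%:R * chi (toF b * u.2) : C).
  by apply: eq_bigr => b _; rewrite NuE.
rewrite (sum_toF (fun b => (b == b + u.1)%:R * chi (b * u.2))) mul0r.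
have e b : (b == b + u.1) = (u.1 == 0) by rewrite -{1}[b]addr0 (inj_eq (addrI b)) eq_sym.
under eq_bigr => b _ do rewrite e.
case: eqP => [u10|_]; last by rewrite big1 // => b _; rewrite mul0r.
have u20 : u.2 != 0.
  by apply: contra_neq u0 => u20; rewrite [u]surjective_pairing u10 u20.
under eq_bigr => b _ do rewrite mul1r.
set s := \sum_b _.
(* Translating the summation variable by 1 multiplies the sum by [chi u.2], which differs from 1, so
   the sum vanishes. *)
have : s = chi u.2 * s.
  rewrite /s [LHS](reindex_inj (addrI 1)) mulr_sumr; apply: eq_bigr => b _.
  by rewrite mulrDl mul1r chiD.
move/eqP; rewrite -subr_eq0 -{1}[s]mul1r -mulrBl mulf_eq0 subr_eq0 eq_sym.
by case/orP => [/eqP/chi_eq1 h|/eqP //]; rewrite h eqxx in u20.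
Qed.

Variable n : nat.
Local Notation V := ('M['F_d]_(n, 2)).
Local Notation N := (@Nx R d omega n).

Lemma NxM (x y : V) : N x *m N y = chi (- \sum_k x k 1 * y k 0) *: N (x + y).
Proof.
rewrite /Nx mkopM -mkopZ; apply: eq_mkop => i j.
under eq_bigr => k _ do rewrite -big_split /=.
(* A sum over basis labels of a product over qudits is a product of single-qudit sums, which reduces
   the claim to [NuM]. *)
rewrite -(bigA_distr_bigA (fun k c => Nu omega (x k 0, x k 1) (i k) c * Nu omega (y k 0, y k 1) c (j k))) /=.
rewrite -sumrN chi_sum -big_split /=; apply: eq_bigr => k _.
have := NuM (x k 0, x k 1) (y k 0, y k 1) => /matrixP/(_ (i k) (j k)).
rewrite mxE => ->; have -> : ((x + y) k 0, (x + y) k 1) = (x k 0, x k 1) + (y k 0, y k 1).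
  by rewrite !mxE.
by rewrite mxE.
Qed.

Lemma Nx0 : N 0 = 1%:M.
Proof.
rewrite -mkop1; apply: eq_mkop => i j.
transitivity (\prod_k (i k == j k)%:R : C).
  by apply: eq_bigr => k _; rewrite (_ : ((0 : V) k 0, (0 : V) k 1) = 0) ?Nu0 ?mxE.
have [->|nij] := eqVneq i j; first by rewrite big1 // => k _; rewrite eqxx.
have /forallPn /= [k ijk] : ~~ [forall k, i k == j k].
  by apply: contraNN nij => /forallP h; apply/eqP/ffunP => k; apply/eqP.
by rewrite (bigD1 k) //= (negPf ijk) mul0r.
Qed.

Lemma Nx_unitary x : adj (N x) *m N x = 1%:M.
Proof.
rewrite /Nx mkop_adj mkopM -mkop1; apply: eq_mkop => i j.
under eq_bigr => k _ do rewrite rmorph_prod -big_split /=.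
rewrite -(bigA_distr_bigA (fun k c => (Nu omega (x k 0, x k 1) c (i k))^* * Nu omega (x k 0, x k 1) c (j k))) /=.
transitivity (\prod_k (i k == j k)%:R : C).
  apply: eq_bigr => k _.
  have := Nu_unitary (x k 0, x k 1) => /matrixP/(_ (i k) (j k)).
  rewrite mxE [RHS]mxE => <-; apply: eq_bigr => c _.
  by rewrite [X in _ = X * _]mxE [X in _ = X * _]mxE.
have [->|nij] := eqVneq i j; first by rewrite big1 // => k _; rewrite eqxx.
have /forallPn /= [k ijk] : ~~ [forall k, i k == j k].
  by apply: contraNN nij => /forallP h; apply/eqP/ffunP => k; apply/eqP.
by rewrite (bigD1 k) //= (negPf ijk) mul0r.
Qed.

Lemma Nx_tr x : \tr (N x) = (x == 0)%:R * (d ^ n)%:R.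
Proof.
rewrite /Nx mkop_tr -(bigA_distr_bigA (fun k c => Nu omega (x k 0, x k 1) c c)) /=.
have [->|x0] := eqVneq x 0.
  under eq_bigr => k _ do rewrite -[\sum__ _]/(\tr _) Nu_tr !mxE eqxx mul1r.
  by rewrite prodr_const card_ord natrX mul1r.
have [k xk] : exists k, (x k 0, x k 1) != 0.
  apply/existsP; apply: contraNT x0; rewrite negb_exists => /forallP h.
  apply/eqP/matrixP => k l; have := h k; rewrite negbK => /eqP [h0 h1].
  by rewrite mxE; case: l => [[|[|//]] ll]; [rewrite -[RHS]h0|rewrite -[RHS]h1]; congr (x k _); apply/val_inj.
by rewrite (bigD1 k) //= -[\sum__ _]/(\tr _) Nu_tr (negPf xk) !mul0r.
Qed.

End Pauli.

(** * Isotropic subgroups *)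

Section Symplectic.
Variables (R : realType) (d : nat) (omega : R[i]).
Hypothesis d_prime : prime d.
Hypothesis omega_prim : d.-primitive_root omega.
Variable n : nat.
Local Notation C := (R[i]).
Local Notation V := ('M['F_d]_(n, 2)).
Local Notation chi := (chi omega).
Implicit Types (x y z : V) (L M : {set V}).

Lemma sympDr x y z : symp x (y + z) = symp x y + symp x z.
Proof. by rewrite /symp -big_split /=; apply: eq_bigr => i _; rewrite !mxE; ring. Qed.

Lemma sympZr x a y : symp x (a *: y) = a * symp x y.
Proof. by rewrite /symp mulr_sumr; apply: eq_bigr => i _; rewrite !mxE; ring. Qed.

Lemma symp_anti x y : symp x y = - symp y x.
Proof. by rewrite /symp -sumrN; apply: eq_bigr => i _; ring. Qed.

Lemma sympxx x : symp x x = 0.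
Proof. by rewrite /symp big1 // => i _; rewrite mulrC subrr. Qed.

Lemma symp0r x : symp x 0 = 0.
Proof. by rewrite -(scale0r x) sympZr mul0r. Qed.

Lemma sympBr x y z : symp x (y - z) = symp x y - symp x z.
Proof. by rewrite -scaleN1r sympDr sympZr mulN1r. Qed.

Lemma sympDl x y z : symp (x + y) z = symp x z + symp y z.
Proof. by rewrite ![symp _ z]symp_anti sympDr opprD. Qed.

Lemma sympZl x a y : symp (a *: x) y = a * symp x y.
Proof. by rewrite ![symp _ y]symp_anti sympZr mulrN. Qed.

Lemma symp_nondeg x : (forall y, symp x y = 0) -> x = 0.
Proof.
move=> h; apply/matrixP => k l; rewrite mxE.
case: l => [[|[|//]] ll].
  have := h (delta_mx k 1); rewrite /symp (bigD1 k) //= big1 => [|i /negPf ik].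
    rewrite !mxE eqxx /= mulr1 mulr0 subr0 addr0 => <-; congr (x k _); exact: val_inj.
  by rewrite !mxE ik /= !mulr0 subr0.
have := h (delta_mx k 0); rewrite /symp (bigD1 k) //= big1 => [|i /negPf ik].
  rewrite !mxE eqxx /= mulr1 mulr0 sub0r addr0 => /eqP; rewrite oppr_eq0 => /eqP <-.
  by congr (x k _); exact: val_inj.
by rewrite !mxE ik /= !mulr0 subr0.
Qed.

(** Over a prime field additive subgroups are already subspaces ([zgroupZ]). Finite sets give direct
    access to cardinalities and to sums over cosets. *)
Definition zgroup L := (0 \in L) && [forall x in L, forall y in L, x - y \in L].

Lemma zgroup0 L : zgroup L -> 0 \in L.
Proof. by case/andP. Qed.

Lemma zgroupB L : zgroup L -> {in L &, forall x y, x - y \in L}.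
Proof. by case/andP => _ /forall_inP h x y xL yL; have /forall_inP := h x xL; apply. Qed.

Lemma zgroupI L : 0 \in L -> {in L &, forall x y, x - y \in L} -> zgroup L.
Proof. by move=> h0 h; rewrite /zgroup h0; do 2 (apply/forall_inP => ? ?); exact: h. Qed.

Lemma zgroupN L : zgroup L -> {in L, forall x, - x \in L}.
Proof. by move=> gL x xL; rewrite -sub0r (zgroupB gL) ?(zgroup0 gL). Qed.

Lemma zgroupD L : zgroup L -> {in L &, forall x y, x + y \in L}.
Proof. by move=> gL x y xL yL; rewrite -[y]opprK (zgroupB gL) ?(zgroupN gL). Qed.

Lemma zgroupZ L : zgroup L -> forall a, {in L, forall x, a *: x \in L}.
Proof.
move=> gL a x xL; rewrite -[a]natr_Zp scaler_nat; elim: (nat_of_ord a) => [|k IH].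
  by rewrite mulr0n (zgroup0 gL).
by rewrite mulrS (zgroupD gL).
Qed.

Lemma zgroup_addr L x y : zgroup L -> y \in L -> (x + y \in L) = (x \in L).
Proof.
move=> gL yL; apply/idP/idP => h; last exact: zgroupD.
by rewrite -(addrK y x) (zgroupB gL).
Qed.

Lemma zgroup_addl L x y : zgroup L -> x \in L -> (x + y \in L) = (y \in L).
Proof. by move=> gL xL; rewrite addrC zgroup_addr. Qed.

Lemma zgroup_subC L x y : zgroup L -> (x - y \in L) = (y - x \in L).
Proof. by move=> gL; apply/idP/idP => /(zgroupN gL); rewrite opprB. Qed.

Definition perp L : {set V} := [set y | [forall x in L, symp x y == 0]].

Lemma perpP L y : reflect (forall x, x \in L -> symp x y = 0) (y \in perp L).
Proof.
rewrite inE; apply: (iffP forall_inP) => h x /h; first by move/eqP.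
by move=> ->.
Qed.

Lemma perp_zgroup L : zgroup (perp L).
Proof.
apply: zgroupI => [|x y /perpP hx /perpP hy]; apply/perpP => z zL; first exact: symp0r.
by rewrite sympBr hx // hy // subr0.
Qed.

(** Orthogonality of characters: if some [l] in [L] is not orthogonal to [x], translation by [l]
    multiplies the sum by a phase different from 1. *)
Lemma chi_sum_zgroup L x : zgroup L ->
  \sum_(y in L) chi (symp x y) = (x \in perp L)%:R * #|L|%:R.
Proof.
move=> gL; have [xp|] := boolP (x \in perp L).
  rewrite mul1r -sumr_const; apply: eq_bigr => y yL.
  by rewrite symp_anti (perpP _ _ xp) // oppr0 chi0.
rewrite inE negb_forall_in => /exists_inP [l lL sl].
rewrite mul0r; set s := \sum_(_ in _) _.
have : s = chi (symp x l) * s.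
  rewrite /s [LHS](reindex_inj (addrI l)) mulr_sumr; apply: eq_big => y.
    by rewrite zgroup_addl.
  by rewrite sympDr chiD.
move/eqP; rewrite -subr_eq0 -{1}[s]mul1r -mulrBl mulf_eq0 subr_eq0 eq_sym.
case/orP => [/eqP/(chi_eq1 d_prime omega_prim) h|/eqP //].
by rewrite symp_anti h oppr0 eqxx in sl.
Qed.

Lemma setT_zgroup : zgroup (finset.setT : {set V}).
Proof. by apply: zgroupI => [|x y _ _]; exact: finset.in_setT. Qed.

Lemma card_V : #|V| = (d ^ n * d ^ n)%N.
Proof. by rewrite card_mx card_Fp // -expnD addnn muln2. Qed.

Lemma chi_sumT y : \sum_x chi (symp x y) = (y == 0)%:R * #|V|%:R.
Proof.
transitivity (\sum_(x in (finset.setT : {set V})) chi (symp (- y) x)).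
  apply: eq_big => x; first by rewrite inE.
  by move=> _; rewrite -scaleN1r sympZl mulN1r -symp_anti.
rewrite chi_sum_zgroup ?setT_zgroup // finset.cardsT; congr (_%:R * _); congr nat_of_bool.
apply/idP/eqP => [/perpP h|->]; last by rewrite oppr0 zgroup0 ?perp_zgroup.
apply/oppr_inj; rewrite oppr0; apply: symp_nondeg => z.
by rewrite symp_anti h ?inE // oppr0.
Qed.

(** The double sum of [chi (symp x y)] over all [x] and over [y] in [L] is evaluated in both orders:
    one gives the left side, the other leaves only [y = 0]. *)
Lemma card_perp L : zgroup L -> (#|L| * #|perp L| = #|V|)%N.
Proof.
move=> gL.
have : \sum_x \sum_(y in L) chi (symp x y) = \sum_(y in L) \sum_x chi (symp x y).
  exact: exchange_big.
under eq_bigr => x _ do rewrite chi_sum_zgroup //.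
under [RHS]eq_bigr => y _ do rewrite chi_sumT.
rewrite -mulr_suml [X in _ = X](bigD1 0) ?zgroup0 //= eqxx mul1r.
rewrite [X in _ = _ + X]big1 => [|y /andP [_ /negPf ->]]; last by rewrite mul0r.
rewrite addr0 -natr_sum.
have -> : (\sum_x (x \in perp L) = #|perp L|)%N by rewrite -sum1_card [RHS]big_mkcond; apply: eq_bigr => x _; case: ifP.
by rewrite -natrM => /eqP; rewrite eqr_nat mulnC => /eqP.
Qed.

Lemma zgroup_card_gt0 L : zgroup L -> (0 < #|L|)%N.
Proof. by move=> gL; apply/card_gt0P; exists 0; exact: zgroup0. Qed.

Definition adjoin L y : {set V} := [set p.1 + p.2 *: y | p in finset.setX L (finset.setT : {set 'F_d})].

Lemma adjoinP L y z : reflect (exists2 x, x \in L & exists c, z = x + c *: y) (z \in adjoin L y).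
Proof.
apply: (iffP imsetP) => [[[x c]]|[x xL [c ->]]].
  by rewrite inE /= => /andP [xL _] ->; exists x => //; exists c.
by exists (x, c); rewrite // !inE xL.
Qed.

Lemma adjoin_zgroup L y : zgroup L -> zgroup (adjoin L y).
Proof.
move=> gL; apply: zgroupI.
  by apply/adjoinP; exists 0; [exact: zgroup0|exists 0; rewrite scale0r addr0].
move=> _ _ /adjoinP [x xL [c ->]] /adjoinP [x' xL' [c' ->]].
apply/adjoinP; exists (x - x'); first exact: zgroupB.
by exists (c - c'); rewrite scalerBl opprD addrACA.
Qed.

Lemma sub_adjoin L y : L \subset adjoin L y.
Proof. by apply/fintype.subsetP => x xL; apply/adjoinP; exists x => //; exists 0; rewrite scale0r addr0. Qed.

Lemma mem_adjoin L y : zgroup L -> y \in adjoin L y.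
Proof. by move=> gL; apply/adjoinP; exists 0; [exact: zgroup0|exists 1; rewrite scale1r add0r]. Qed.

Lemma card_adjoin L y : zgroup L -> y \notin L -> (#|adjoin L y| = #|L| * d)%N.
Proof.
move=> gL yL; rewrite card_in_imset ?cardsX ?finset.cardsT ?card_Fp //.
move=> [x c] [x' c']; rewrite !inE /= !andbT => xL xL' e.
have e2 : (c - c') *: y = x' - x.
  by apply/eqP; rewrite scalerBl subr_eq addrAC eq_sym subr_eq -e addrC.
have [/eqP|cc] := eqVneq (c - c') 0.
  rewrite subr_eq0 => /eqP cc; move: e; rewrite cc => /addIr -> //.
case/negP: yL; rewrite -(scalerK cc y) e2.
by apply: zgroupZ => //; exact: zgroupB.
Qed.

Lemma mem_perp_adjoin L y z :
  zgroup L -> (z \in perp (adjoin L y)) = (z \in perp L) && (symp y z == 0).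
Proof.
move=> gL; apply/idP/andP => [/perpP h|[/perpP h /eqP h']].
  split; last by apply/eqP/h/mem_adjoin.
  by apply/perpP => x xL; apply: h; exact: (fintype.subsetP (sub_adjoin L y)).
apply/perpP => _ /adjoinP [x xL [c ->]].
by rewrite sympDl h // sympZl h' mulr0 addr0.
Qed.

Lemma adjoin_isotropic L y : zgroup L -> L \subset perp L -> y \in perp L ->
  adjoin L y \subset perp (adjoin L y).
Proof.
move=> gL /fintype.subsetP iL yL; apply/fintype.subsetP => _ /adjoinP [x xL [c ->]].
rewrite mem_perp_adjoin // (zgroupD (perp_zgroup L)) ?(iL x xL) //=; last first.
  by apply: zgroupZ => //; exact: perp_zgroup.
by rewrite sympDr sympZr sympxx mulr0 addr0 symp_anti (perpP _ _ yL) ?oppr0.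
Qed.

(** The set on the left is [perp (adjoin L z)] without [L]. The first has index [d] in [perp L], and
    removing [L] from both sides can only help the inequality. *)
Lemma card_perp_pairs L z : zgroup L -> L \subset perp L -> z \in perp L :\: L ->
  (d * #|[set y in perp L :\: L | symp z y == 0%R]| <= #|perp L :\: L|)%N.
Proof.
move=> gL iL; rewrite finset.in_setD => /andP [zL zp].
have -> : [set y in perp L :\: L | symp z y == 0] = perp (adjoin L z) :\: L.
  by apply/finset.setP => y; rewrite inE !finset.in_setD mem_perp_adjoin // andbA.
have sL : L \subset perp (adjoin L z).
  by rewrite (fintype.subset_trans (sub_adjoin L z)) // adjoin_isotropic.
rewrite !cardsD (finset.setIidPr sL) (finset.setIidPr iL) mulnBr.
have -> : (d * #|perp (adjoin L z)| = #|perp L|)%N.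
  apply/eqP; rewrite -(eqn_pmul2l (zgroup_card_gt0 gL)) card_perp //.
  by rewrite mulnA -(card_adjoin gL zL) card_perp ?adjoin_zgroup.
by rewrite leq_sub2l // leq_pmull // prime_gt0.
Qed.

(* Averaging over y in perp L \ L: each z in perp L \ L stays orthogonal to
   the extension by y for at most a fraction 1/d of the choices of y. *)
Lemma isotropic_extension L (w : V -> R) : (forall z, 0 <= w z) ->
  zgroup L -> L \subset perp L -> (#|L| < #|perp L|)%N ->
  exists2 y, y \in perp L :\: L &
   d%:R * \sum_(z in perp (adjoin L y) :\: adjoin L y) w z <= \sum_(z in perp L :\: L) w z.
Proof.
move=> w0 gL iL ltL; set A := perp L :\: L.
have A0 : (0 < #|A|)%N by rewrite /A cardsD (finset.setIidPr iL) subn_gt0.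
pose Phi y := \sum_(z in perp (adjoin L y) :\: adjoin L y) w z.
have [/exists_inP [y yA h]|] := boolP [exists y in A, d%:R * Phi y <= \sum_(z in A) w z].
  by exists y.
(* If every [y] failed, summing the failures over [y] would contradict the bound that follows from
   exchanging the two sums. *)
rewrite negb_exists_in => /forall_inP h; exfalso.
have h1 : \sum_(y in A) \sum_(z in A) w z < \sum_(y in A) d%:R * Phi y.
  apply: ltr_sum => [|y yA]; last by rewrite ltNge h.
  by case/card_gt0P: A0 => y yA; apply/hasP; exists y; rewrite ?mem_index_enum.
have h2 y : y \in A -> Phi y <= \sum_(z in A | symp z y == 0) w z.
  move=> yA; rewrite /Phi [leLHS]big_mkcond [leRHS]big_mkcond; apply: ler_sum => z _.
  case: ifP => [|_]; last by case: ifP.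
  rewrite finset.in_setD mem_perp_adjoin // => /and3P [zn zp zy].
  rewrite /A finset.in_setD zp symp_anti oppr_eq0 zy !andbT ifT //.
  by apply: contraNN zn; apply: (fintype.subsetP (sub_adjoin L y)).
have h3 : \sum_(y in A) d%:R * Phi y <= \sum_(y in A) \sum_(z in A) w z.
  rewrite -mulr_sumr (le_trans (ler_wpM2l _ (ler_sum _ h2))) //.
  rewrite (exchange_big_dep (mem A)) => [|y z _ /andP [] //] /=.
  rewrite mulr_sumr [leRHS]sumr_const -[leRHS]mulr_natl [leRHS]mulr_sumr.
  apply: ler_sum => z zA.
  have -> : \sum_(y in A | (z \in A) && (symp z y == 0)) w z = w z *+ #|[set y in A | symp z y == 0%R]|.
    by rewrite -sumr_const; apply: eq_bigl => y; rewrite inE zA.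
  rewrite -[w z *+ _]mulr_natl mulrA -natrM ler_wpM2r // ler_nat.
  exact: card_perp_pairs.
by have := lt_le_trans h1 h3; rewrite ltxx.
Qed.

Lemma isotropic_tower a L (w : V -> R) : (forall z, 0 <= w z) ->
  zgroup L -> L \subset perp L -> (#|L| * d ^ a <= d ^ n)%N ->
  exists M, [/\ zgroup M, M \subset perp M, L \subset M, #|M| = (#|L| * d ^ a)%N &
   (d ^ a)%:R * \sum_(z in perp M :\: M) w z <= \sum_(z in perp L :\: L) w z].
Proof.
move=> w0; elim: a L => [|a IH] L gL iL cL.
  by exists L; split; rewrite ?muln1 ?mul1r.
have d1 := prime_gt1 d_prime.
have ltL : (#|L| < d ^ n)%N.
  apply: leq_trans cL; rewrite -[X in (X < _)%N]muln1 ltn_pmul2l ?zgroup_card_gt0 //.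
  by rewrite -{1}(expn0 d) ltn_exp2l.
(* Room for a further extension: [L] has fewer than [d ^ n] elements, while the two cardinalities
   multiply to [d ^ n * d ^ n]. *)
have ltP : (#|L| < #|perp L|)%N.
  rewrite -(ltn_pmul2l (zgroup_card_gt0 gL)) card_perp // card_V.
  by rewrite ltn_mul.
have [y yA hy] := isotropic_extension w0 gL iL ltP.
move: yA; rewrite finset.in_setD => /andP [yL yp].
have [|M [gM iM sM cM hM]] := IH (adjoin L y) (adjoin_zgroup y gL) (adjoin_isotropic gL iL yp).
  by rewrite card_adjoin // -mulnA -expnS.
exists M; split => //; first by apply: fintype.subset_trans sM; exact: sub_adjoin.
  by rewrite cM card_adjoin // -mulnA -expnS.
apply: le_trans hy; rewrite expnS natrM -mulrA ler_wpM2l //.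
Qed.

End Symplectic.

(** * Stabilizer projections *)

Section MatrixFacts.
Variable R : realType.
Local Notation C := (R[i]).

Lemma mxtrace_adjM_ge0 m p (A : 'M[C]_(m, p)) : 0 <= \tr (adj A *m A).
Proof.
apply: sumr_ge0 => i _; rewrite mxE; apply: sumr_ge0 => j _.
by rewrite !mxE mulrC mul_conjC_ge0.
Qed.

Lemma mxtrace_adjM_eq0 m p (A : 'M[C]_(m, p)) : \tr (adj A *m A) = 0 -> A = 0.
Proof.
have h j i : 0 <= adj A i j * A j i by rewrite !mxE mulrC mul_conjC_ge0.
move/eqP; rewrite psumr_eq0 => [/allP h1|i _]; last by rewrite mxE; exact: sumr_ge0.
apply/matrixP => j i; have := h1 i (mem_index_enum i); rewrite /= mxE psumr_eq0 // => /allP.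
move/(_ j (mem_index_enum j)); rewrite /= !mxE mulf_eq0 fmorph_eq0 orbb.
by move/eqP.
Qed.

Lemma adjM_eq0 m p (A : 'M[C]_(m, p)) : adj A *m A = 0 -> A = 0.
Proof. by move=> h; apply: mxtrace_adjM_eq0; rewrite h linear0. Qed.

End MatrixFacts.

(** In [A *m A = A], with [A] replaced by its rank factorisation, the outer full-rank factors
    cancel. *)
Lemma idem_base (F : fieldType) D (A : 'M[F]_D) : A *m A = A ->
  row_base A *m col_base A = 1%:M.
Proof.
move=> AA; apply: (row_free_inj (row_base_free A)); rewrite /= mul1mx.
apply: (row_full_inj (col_base_full A)).
by rewrite -(mulmxA (row_base A)) mulmxA !mulmx_base.
Qed.

Lemma idem_mxtrace (F : fieldType) D (A : 'M[F]_D) : A *m A = A ->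
  \tr A = (\rank A)%:R.
Proof. by move=> AA; rewrite -{1}(mulmx_base A) mxtrace_mulC idem_base // mxtrace1. Qed.

Section Stabilizer.
Variables (R : realType) (d : nat) (omega : R[i]).
Hypothesis d_prime : prime d.
Hypothesis omega_prim : d.-primitive_root omega.
Variable n : nat.
Local Notation C := (R[i]).
Local Notation V := ('M['F_d]_(n, 2)).
Local Notation chi := (chi omega).
Local Notation N := (@Nx R d omega n).
Local Notation D := #|qidx d n|.
Implicit Types (x y z : V) (L M : {set V}).
Local Opaque Nx.

Lemma Nx_comm x y : N x *m N y = chi (symp x y) *: (N y *m N x).
Proof.
rewrite !(NxM d_prime omega_prim) scalerA [y + x]addrC -chiD //; congr (chi _ *: _).
rewrite /symp -!sumrN -big_split; apply: eq_bigr => i _ /=; ring.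
Qed.

Lemma Nx_unitaryV x : N x *m adj (N x) = 1%:M.
Proof. exact/mulmx1C/Nx_unitary. Qed.

Lemma Nx_conj x y : N x *m N y *m adj (N x) = chi (symp x y) *: N y.
Proof. by rewrite Nx_comm -scalemxAl -mulmxA Nx_unitaryV mulmx1. Qed.

Lemma adj_Nx x : adj (N x) = (chi (- \sum_k x k 1 * (- x) k 0))^* *: N (- x).
Proof.
set c := chi _; have cc : c^* * c = 1 by rewrite chi_conj // chiNM.
rewrite -[LHS]mulmx1 -(@Nx0 R d omega n) -(subrr x).
have -> : N (x - x) = c^* *: (N x *m N (- x)).
  by rewrite NxM // scalerA cc scale1r.
by rewrite -scalemxAr mulmxA Nx_unitary // mul1mx.
Qed.

Lemma NxM_tr x y : x + y != 0 -> \tr (N x *m N y) = 0.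
Proof. by move=> /negPf xy; rewrite NxM // mxtraceZ Nx_tr // xy mul0r mulr0. Qed.

(** On an isotropic set the operators commute, so they share an eigenvector. They are transposed
    because [common_eigenvector] yields a row vector. *)
Lemma isotropic_eigenvector L : L \subset perp L ->
  exists psi : 'cV[C]_D, exists tau : V -> C,
    psi != 0 /\ forall x, x \in L -> N x *m psi = tau x *: psi.
Proof.
move=> /fintype.subsetP iL.
have D0 : (0 < D)%N.
  by rewrite card_ffun !card_ord expn_gt0 prime_gt0.
have cm : {in [seq (N x)^T | x <- enum L] &, forall A B : 'M_D, comm_mx A B}.
  move=> _ _ /mapP [x + ->] /mapP [y + ->]; rewrite !mem_enum => xL yL.
  rewrite /comm_mx -!trmx_mul Nx_comm (perpP _ _ (iL x xL)) //.
  by rewrite chi0 scale1r.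
have [v v0 /allP hv] := common_eigenvector D0 cm.
have /choice [tau ht] : forall x, exists a, x \in L -> N x *m v^T = a *: v^T.
  move=> x; have [xL|] := boolP (x \in L); last by exists 0.
  have /sub_rVP [a ha] : stablemx v (N x)^T by apply: hv; apply: map_f; rewrite mem_enum.
  by exists a => _; apply: trmx_inj; rewrite trmx_mul linearZ /= !trmxK.
by exists v^T, tau; split => //; rewrite trmx_eq0.
Qed.

Variables (L : {set V}) (tau : V -> C) (psi0 : 'cV[C]_D).
Hypothesis gL : zgroup L.
Hypothesis iL : L \subset perp L.
Hypothesis psi0_neq0 : psi0 != 0.
Hypothesis psi0_eigen : forall x, x \in L -> N x *m psi0 = tau x *: psi0.

(** A unitary preserves the norm of its eigenvector [psi0], so the eigenvalue has modulus 1. *)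
Lemma tau_conj x : x \in L -> (tau x)^* * tau x = 1.
Proof.
move=> xL; have := Nx_unitary d_prime omega_prim x.
move=> /(congr1 (fun A => adj psi0 *m A *m psi0)); rewrite mulmx1 mulmxA -hadjM -mulmxA psi0_eigen //.
rewrite hadjZ -scalemxAl -scalemxAr scalerA => /eqP.
rewrite -subr_eq0 -{2}[adj _ *m _]scale1r -scalerBl scaler_eq0 subr_eq0.
by case/orP => [/eqP //|/eqP/adjM_eq0 h]; move: psi0_neq0; rewrite h eqxx.
Qed.

Lemma scale_psi0_inj a b : a *: psi0 = b *: psi0 -> a = b.
Proof.
move/eqP; rewrite -subr_eq0 -scalerBl scaler_eq0 (negPf psi0_neq0) orbF subr_eq0.
by move/eqP.
Qed.

Lemma tau0 : tau 0 = 1.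
Proof.
apply: scale_psi0_inj; rewrite -psi0_eigen ?zgroup0 // Nx0 //.
by rewrite mul1mx scale1r.
Qed.

Lemma tauM x y : x \in L -> y \in L ->
  tau x * tau y = chi (- \sum_k x k 1 * y k 0) * tau (x + y).
Proof.
move=> xL yL; apply: scale_psi0_inj.
rewrite -[RHS]scalerA -psi0_eigen ?zgroupD // scalemxAl -NxM // -mulmxA.
by rewrite psi0_eigen // -scalemxAr psi0_eigen // scalerA mulrC.
Qed.

(** Averaging the operators with their eigenvalues divided out gives the orthogonal projection onto
    the joint eigenspace. *)
Definition stab_proj : 'M[C]_D := #|L|%:R^-1 *: \sum_(x in L) (tau x)^* *: N x.
Local Notation Pi := stab_proj.

Let cL : #|L|%:R != 0 :> C.
Proof. by rewrite pnatr_eq0 -lt0n zgroup_card_gt0. Qed.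

Lemma stab_proj_fix m (A : 'M[C]_(D, m)) :
  (forall x, x \in L -> N x *m A = tau x *: A) -> Pi *m A = A.
Proof.
move=> h; rewrite -scalemxAl mulmx_suml.
have -> : \sum_(x in L) (tau x)^* *: N x *m A = #|L|%:R *: A.
  rewrite scaler_nat -sumr_const; apply: eq_bigr => x xL.
  by rewrite -scalemxAl h // scalerA tau_conj // scale1r.
by rewrite scalerA mulVf // scale1r.
Qed.

Lemma Nx_stab_proj y : y \in L -> N y *m Pi = tau y *: Pi.
Proof.
move=> yL; rewrite /Pi -scalemxAr scalerA mulrC -scalerA; congr (_ *: _).
rewrite mulmx_sumr scaler_sumr [RHS](reindex_inj (addrI y)) /=; apply: eq_big => x.
  by rewrite zgroup_addl.
move=> xL; rewrite -scalemxAr NxM // !scalerA; congr (_ *: _).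
have xyL := zgroupD gL yL xL.
have h := tauM yL xL.
apply: (mulIf (_ : tau x != 0)).
  by apply: contra_eq_neq (tau_conj xL) => ->; rewrite mulr0 eq_sym oner_eq0.
by rewrite mulrAC tau_conj // mul1r mulrAC h -mulrA [tau _ * _]mulrC tau_conj ?mulr1.
Qed.

Lemma stab_proj_idem : Pi *m Pi = Pi.
Proof. by apply: stab_proj_fix => x xL; rewrite Nx_stab_proj. Qed.

Lemma stab_proj_adj : adj Pi = Pi.
Proof.
rewrite /Pi hadjZ fmorphV rmorph_nat; congr (_ *: _); rewrite hadj_sum.
rewrite [RHS](reindex_inj oppr_inj) /=; apply: eq_big => x.
  by apply/idP/idP => /(zgroupN gL); rewrite ?opprK.
move=> xL; rewrite hadjZ conjCK adj_Nx scalerA; congr (_ *: _).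
have xL' := zgroupN gL xL; have := tauM xL xL'; rewrite subrr tau0 mulr1 => <-.
by rewrite rmorphM /= mulrA [tau x * _]mulrC tau_conj // mul1r.
Qed.

Lemma stab_proj_comm y : y \in perp L -> N y *m Pi = Pi *m N y.
Proof.
move=> /perpP yp; rewrite /Pi -scalemxAr -scalemxAl mulmx_sumr mulmx_suml; congr (_ *: _).
apply: eq_bigr => x xL; rewrite -scalemxAr -scalemxAl; congr (_ *: _).
by rewrite Nx_comm symp_anti yp // oppr0 chi0 scale1r.
Qed.

(** Take [l] in [L] not orthogonal to [y]. In [Pi N_y N_l Pi] the factor [N l] can be absorbed on
    the right, or moved past [N y] and absorbed on the left; the results differ by a phase that is
    not 1. *)
Lemma stab_proj_orth y : y \notin perp L -> Pi *m N y *m Pi = 0.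
Proof.
rewrite inE negb_forall_in => /exists_inP [l lL sl].
have e1 : Pi *m N y *m (N l *m Pi) = tau l *: (Pi *m N y *m Pi).
  by rewrite Nx_stab_proj // -scalemxAr.
have e2 : Pi *m N y *m (N l *m Pi) = (chi (symp y l) * tau l) *: (Pi *m N y *m Pi).
  have lp : l \in perp L by exact: (fintype.subsetP iL).
  rewrite mulmxA -(mulmxA Pi) Nx_comm -[Pi *m (chi _ *: _)]scalemxAr (mulmxA Pi) -(stab_proj_comm lp).
  by rewrite Nx_stab_proj // -!scalemxAl !scalerA.
have : (chi (symp y l) * tau l - tau l) *: (Pi *m N y *m Pi) = 0.
  by rewrite scalerBl -e1 -e2 subrr.
move/eqP; rewrite scaler_eq0 -{2}[tau l]mul1r -mulrBl mulf_eq0 subr_eq0.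
case/orP => [/orP [/eqP/(chi_eq1 d_prime omega_prim) h|/eqP h]|/eqP //].
  by rewrite symp_anti h oppr0 eqxx in sl.
by have := tau_conj lL; rewrite h mulr0 => /eqP; rewrite eq_sym oner_eq0.
Qed.

Lemma stab_proj_tr y : \tr (N y *m Pi) = (y \in L)%:R * (tau y * ((d ^ n)%:R / #|L|%:R)).
Proof.
have [yL|yL] := boolP (y \in L); last first.
  rewrite mul0r /Pi -scalemxAr mxtraceZ mulmx_sumr raddf_sum big1 ?mulr0 //= => x xL.
  rewrite -scalemxAr mxtraceZ NxM_tr ?mulr0 //.
  by apply: contraNN yL => /eqP e; rewrite -(addrK x y) e sub0r zgroupN.
rewrite mul1r Nx_stab_proj // mxtraceZ; congr (_ * _).
rewrite /Pi mxtraceZ mulrC; congr (_ / _); rewrite raddf_sum (bigD1 0) ?zgroup0 //= big1.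
  by rewrite addr0 mxtraceZ tau0 rmorph1 mul1r Nx_tr // eqxx mul1r.
by move=> x /andP [_ /negPf x0]; rewrite mxtraceZ Nx_tr // x0 mul0r mulr0.
Qed.

Lemma stab_proj_rank : (\rank Pi * #|L| = d ^ n)%N.
Proof.
apply/eqP; rewrite -(eqr_nat C) natrM -(idem_mxtrace stab_proj_idem).
rewrite -[Pi]mul1mx -(@Nx0 R d omega n) stab_proj_tr zgroup0 // tau0 !mul1r.
by rewrite divfK.
Qed.

(** Conjugation by [N x] multiplies [N y] by [chi (symp x y)], so the sum over all [x] kills every
    term of the average except [y = 0]. This makes the recovery below trace preserving. *)
Lemma stab_proj_twirl :
  \sum_x N x *m Pi *m adj (N x) = (#|V|%:R / #|L|%:R)%:M.
Proof.
transitivity (#|L|%:R^-1 *: \sum_(y in L) ((tau y)^* * \sum_x chi (symp x y)) *: N y).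
  rewrite scaler_sumr.
  transitivity (\sum_x \sum_(y in L) (#|L|%:R^-1 * (tau y)^* * chi (symp x y)) *: N y).
    apply: eq_bigr => x _; rewrite /Pi -scalemxAr -scalemxAl mulmx_sumr mulmx_suml scaler_sumr.
    by apply: eq_bigr => y _; rewrite -scalemxAr -scalemxAl Nx_conj !scalerA.
  rewrite exchange_big; apply: eq_bigr => y _ /=.
  by rewrite scalerA mulrA mulr_sumr scaler_suml.
under eq_bigr => y _ do rewrite chi_sumT //.
rewrite (bigD1 0) ?zgroup0 //= big1 => [|y /andP [_ /negPf y0]]; last first.
  by rewrite y0 mul0r mulr0 scale0r.
by rewrite addr0 eqxx mul1r tau0 rmorph1 mul1r Nx0 // scalerA scalemx1 mulrC.
Qed.

End Stabilizer.

(** * Fidelity of stabilizer codes *)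

Section Fidelity.
Variable R : realType.
Local Notation C := (R[i]).

Lemma toC_real (r : R) : toC r = r%:C%C.
Proof. by []. Qed.

Lemma toC_conj (r : R) : (toC r)^* = toC r.
Proof.
rewrite toC_real; apply/CrealP.
by rewrite realE -[0]/(0%:C%C) !lecR -realE num_real.
Qed.

Lemma Re_le (x y : C) : x <= y -> complex.Re x <= complex.Re y.
Proof. by case: x y => [a b] [a' b']; rewrite lecE => /andP []. Qed.

Lemma adj00 m (A : 'M[C]_(m, 1)) (B : 'M[C]_(m, 1)) :
  (adj A *m B) 0 0 = ((adj B *m A) 0 0)^*.
Proof.
rewrite !mxE rmorph_sum; apply: eq_bigr => i _.
by rewrite !mxE rmorphM /= conjCK mulrC.
Qed.

Lemma adj00_ge0 m (A : 'M[C]_(m, 1)) : 0 <= (adj A *m A) 0 0.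
Proof. by have := mxtrace_adjM_ge0 A; rewrite /mxtrace big_ord1. Qed.

Lemma adj00_gt0 m (A : 'M[C]_(m, 1)) : A != 0 -> 0 < (adj A *m A) 0 0.
Proof.
move=> A0; rewrite lt_neqAle adj00_ge0 andbT eq_sym; apply: contra_neq A0 => h.
by apply: mxtrace_adjM_eq0; rewrite /mxtrace big_ord1.
Qed.

(** Expand the nonnegative squared norm of [v] minus its component along [psi]. *)
Lemma bessel m (psi v : 'cV[C]_m) : (adj psi *m psi) 0 0 = 1 ->
  (adj psi *m v) 0 0 * ((adj psi *m v) 0 0)^* <= (adj v *m v) 0 0.
Proof.
move=> h; set a := (adj psi *m v) 0 0.
have := adj00_ge0 (v - a *: psi).
have hs m' p (A B : 'M[C]_(m', p)) : adj (A - B) = adj A - adj B.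
  by rewrite -scaleN1r hadjD hadjZ rmorphN1 scaleN1r.
rewrite hs hadjZ mulmxBl !mulmxBr -!scalemxAl -!scalemxAr scalerA.
have E (A1 A2 A3 A4 : 'M[C]_1) :
    (A1 - A2 - (A3 - A4)) 0 0 = A1 0 0 - A2 0 0 - (A3 0 0 - A4 0 0) by rewrite !mxE.
have Z b (A : 'M[C]_1) : (b *: A) 0 0 = b * A 0 0 by rewrite mxE.
rewrite E !Z h [(adj v *m psi) 0 0]adj00 -/a mulr1 [_^* * a]mulrC.
by rewrite subrr subr0 subr_ge0.
Qed.

Variable T : finType.

(** Every pair of Kraus operators contributes a squared modulus, so a lower bound may discard any
    terms. *)
Lemma fidelityE (I J : finType) (K : I -> op R T) (A : J -> op R T) (psi : vec R T) :
  (adj psi *m kraus K (kraus A (psi *m adj psi)) *m psi) 0 0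
  = \sum_i \sum_j (adj psi *m (K i *m A j *m psi)) 0 0
      * ((adj psi *m (K i *m A j *m psi)) 0 0)^*.
Proof.
rewrite /kraus mulmx_sumr mulmx_suml summxE; apply: eq_bigr => i _.
rewrite mulmx_sumr mulmx_suml mulmx_sumr mulmx_suml summxE; apply: eq_bigr => j _.
have -> : adj psi *m (K i *m (A j *m (psi *m adj psi) *m adj (A j)) *m adj (K i)) *m psi
  = (adj psi *m (K i *m A j *m psi)) *m (adj (K i *m A j *m psi) *m psi).
  by rewrite !hadjM !mulmxA.
by rewrite mxE big_ord1 [in X in _ * X = _]adj00.
Qed.

Lemma fidelity_ge0 (I J : finType) (K : I -> op R T) (A : J -> op R T) (psi : vec R T) :
  0 <= complex.Re ((adj psi *m kraus K (kraus A (psi *m adj psi)) *m psi) 0 0).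
Proof.
have h : 0 <= (adj psi *m kraus K (kraus A (psi *m adj psi)) *m psi) 0 0.
  by rewrite fidelityE; do 2 (apply: sumr_ge0 => ? _); exact: mul_conjC_ge0.
exact: (Re_le h).
Qed.

Lemma fidelity_le1 (I J : finType) (K : I -> op R T) (A : J -> op R T) (psi : vec R T) :
  trace_preserving K -> trace_preserving A -> (adj psi *m psi) 0 0 = 1 ->
  complex.Re ((adj psi *m kraus K (kraus A (psi *m adj psi)) *m psi) 0 0) <= 1.
Proof.
move=> tK tA p1.
suff h : (adj psi *m kraus K (kraus A (psi *m adj psi)) *m psi) 0 0 <= 1 by exact: (Re_le h).
rewrite fidelityE -p1.
have tp (I' : finType) (B : I' -> op R T) (v : vec R T) : trace_preserving B ->
    (adj v *m v) 0 0 = \sum_i (adj (B i *m v) *m (B i *m v)) 0 0.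
  move=> tB; rewrite -{2}[v]mul1mx -tB mulmx_suml mulmx_sumr summxE.
  by apply: eq_bigr => i _; rewrite hadjM !mulmxA.
rewrite [leRHS](tp _ A) // exchange_big; apply: ler_sum => j _ /=.
rewrite [leRHS](tp _ K) //; apply: ler_sum => i _ /=.
by rewrite -mulmxA; apply: bessel.
Qed.

(** Ensures that the infimum in [min_fidelity] is taken over a nonempty set. *)
Lemma exists_unit_vector (Cs : {vspace vec R T}) : (0 < \dim Cs)%N ->
  exists psi : vec R T, psi \in Cs /\ (adj psi *m psi) 0 0 = 1.
Proof.
move=> dC; have : vpick Cs != 0 by rewrite vpick0 -dimv_eq0 -lt0n.
set v := vpick Cs => v0; have a0 := adj00_gt0 v0.
set a := (adj v *m v) 0 0 in a0.
exists ((sqrtC a)^-1 *: v); split; first by rewrite memvZ // memv_pick.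
rewrite hadjZ -scalemxAl -scalemxAr scalerA mxE -/a fmorphV /=.
have -> : (sqrtC a)^* = sqrtC a by apply/CrealP; rewrite ger0_real // sqrtC_ge0 ltW.
by rewrite -invfM -expr2 sqrtCK mulVf // gt_eqF.
Qed.

End Fidelity.

Section PauliChannel.
Variables (R : realType) (d : nat) (omega : R[i]) (P : 'F_d * 'F_d -> R).
Hypothesis d_prime : prime d.
Hypothesis omega_prim : d.-primitive_root omega.
Hypothesis P_ge0 : forall u, 0 <= P u.
Hypothesis P_sum1 : \sum_u P u = 1.
Local Notation C := (R[i]).

Lemma sum_rows n (f : 'I_n -> 'F_d * 'F_d -> R) :
  \sum_(x : 'M['F_d]_(n, 2)) \prod_k f k (x k 0, x k 1) = \prod_k \sum_u f k u.
Proof.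
rewrite (bigA_distr_bigA f).
pose g (h : {ffun 'I_n -> 'F_d * 'F_d}) : 'M['F_d]_(n, 2) :=
  \matrix_(i, j) if j == 0 then (h i).1 else (h i).2.
pose g' (x : 'M['F_d]_(n, 2)) : {ffun 'I_n -> 'F_d * 'F_d} := [ffun i => (x i 0, x i 1)].
have gK : cancel g g'.
  by move=> h; apply/ffunP => i; rewrite ffunE !mxE /=; case: (h i).
have g'K : cancel g' g.
  move=> x; apply/matrixP => i j; rewrite !mxE ffunE /=; case: ifP => [/eqP -> //|].
  by case: j => [[|[|//]] jj] //= _; congr (x i _); apply/val_inj.
rewrite (reindex g) /=; last by exists g' => ? _; [exact: gK|exact: g'K].
by apply: eq_bigr => h _; apply: eq_bigr => k _; rewrite !mxE /= -surjective_pairing.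
Qed.

Lemma Pn_ge0 n (x : 'M['F_d]_(n, 2)) : 0 <= Pn P x.
Proof. by apply: prodr_ge0 => k _. Qed.

Lemma Pn_sum1 n : \sum_(x : 'M['F_d]_(n, 2)) Pn P x = 1.
Proof. by rewrite (sum_rows (fun _ => P)) big1. Qed.

Lemma toC_sqrt_sq n (x : 'M['F_d]_(n, 2)) :
  (toC (Num.sqrt (Pn P x)))^* * toC (Num.sqrt (Pn P x)) = toC (Pn P x).
Proof.
rewrite toC_conj !toC_real.
by rewrite -rmorphM /= -expr2 sqr_sqrtr // Pn_ge0.
Qed.

Lemma chanK_trace_preserving n : trace_preserving (@chanK R d omega P n).
Proof.
rewrite /trace_preserving /chanK.
transitivity (\sum_(x : 'M['F_d]_(n, 2)) toC (Pn P x) *: (1%:M : op R (qidx d n))).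
  apply: eq_bigr => x _; rewrite hadjZ -scalemxAl -scalemxAr scalerA toC_sqrt_sq.
  by rewrite Nx_unitary.
rewrite -scaler_suml (_ : \sum__ _ = 1) ?scale1r //.
by have := rmorph_sum (@real_complex R) (index_enum 'M['F_d]_(n, 2)) predT (Pn P (n:=n)); rewrite Pn_sum1 rmorph1 => <-.
Qed.

Lemma Fstar_le1 n (k : R) : 0 <= k -> (Fstar omega P n k <= 1)%E.
Proof.
move=> k0; apply: ge_ereal_sup => _ [Cs [m [Rk [dimC tR ->]]]].
rewrite lee_fin.
have dC : (0 < \dim Cs)%N.
  rewrite -(ltr_nat R); apply: lt_le_trans dimC; apply: powR_gt0.
  by rewrite ltr0n prime_gt0.
have [psi [pC p1]] := exists_unit_vector dC.
apply: (@le_trans _ _ (complex.Re ((adj psi *m kraus Rk (kraus (@chanK R d omega P n) (psi *m adj psi)) *m psi) 0 0))).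
  apply: ge_inf; last by exists psi.
  by exists 0 => _ [phi _ <-]; exact: fidelity_ge0.
by apply: fidelity_le1 => //; exact: chanK_trace_preserving.
Qed.

Section StabilizerCode.
Variable n : nat.
Local Notation V := ('M['F_d]_(n, 2)).
Local Notation N := (@Nx R d omega n).
Local Notation D := #|qidx d n|.
Variables (L : {set V}) (K : nat) (r : V -> V).
Hypothesis gL : zgroup L.
Hypothesis iL : L \subset perp L.
Hypothesis cardL : (#|L| * d ^ K = d ^ n)%N.
Hypothesis r_coset : forall x, r x - x \in perp L.
Hypothesis r_const : forall x y, x - y \in perp L -> r x = r y.

(** [col_base A] embeds a space of dimension [\rank A] injectively into the fixed vectors of [A]. *)
Lemma fixedSpace_dim_ge (A : 'M[C]_D) : A *m A = A ->
  (\rank A <= \dim (fixedSpace (linfun (mulmx A : 'cV_D -> 'cV_D))))%N.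
Proof.
move=> AA; pose g := linfun (mulmx (col_base A) : 'cV_(\rank A) -> 'cV_D).
have k0 : lker g == 0%VS.
  apply/lker0P => u v; rewrite !lfunE /=; exact: (row_full_inj (col_base_full A)).
have <- : \dim (limg g) = \rank A.
  rewrite limg_dim_eq; first by rewrite dimvf /dim /= muln1.
  by rewrite (eqP k0) capv0.
apply: dimvS; apply/subvP => _ /memv_imgP [v _ ->]; apply/fixedSpaceP.
rewrite !lfunE /= -{1}(mulmx_base A) -mulmxA [row_base A *m _]mulmxA idem_base //.
by rewrite mul1mx.
Qed.

Lemma Nx_ratio x y : exists2 a, a^* * a = 1 & N y = a *: (N x *m N (y - x)).
Proof.
exists (chi omega (- \sum_k x k 1 * (y - x) k 0))^*.
  by rewrite conjCK mulrC chi_conj // chiNM.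
by rewrite NxM // scalerA chi_conj // chiNM // scale1r addrC subrK.
Qed.

(** Here [r x] is the error that the decoder assumes upon seeing the syndrome of [x], that is, its
    coset modulo [perp L]. Undoing [r x] corrects [x] when [x - r x] is in [L], since the remaining
    operator is a scalar on the code. *)
Lemma Fstar_ge_stabilizer (k : R) : k <= K%:R ->
  ((\sum_(x | x - r x \in L) Pn P x)%:E <= Fstar omega P n k)%E.
Proof.
move=> kK.
have [psi0 [tau [psi00 psi0e]]] := isotropic_eigenvector d_prime omega_prim iL.
pose Pi := stab_proj omega L tau.
have PiI : Pi *m Pi = Pi by apply: stab_proj_idem psi0e.
have PiA : adj Pi = Pi by apply: stab_proj_adj psi0e.
have rk : \rank Pi = (d ^ K)%N.
  apply/eqP; rewrite -(eqn_pmul2l (zgroup_card_gt0 gL)) cardL mulnC.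
  by apply/eqP; apply: stab_proj_rank psi0e.
have PiC y : y \in perp L -> N y *m Pi = Pi *m N y by exact: stab_proj_comm.
have PiE l : l \in L -> N l *m Pi = tau l *: Pi by apply: Nx_stab_proj psi0e l.
have PiT := stab_proj_twirl d_prime omega_prim gL psi00 psi0e; rewrite -/Pi in PiT.
clearbody Pi.
pose Cs := fixedSpace (linfun (mulmx Pi : 'cV_D -> 'cV_D)).
have CsP v : v \in Cs -> Pi *m v = v by move/fixedSpaceP; rewrite lfunE.
(* The recovery has one Kraus operator per vector [x] rather than per syndrome. Each syndrome is
   thus repeated [#|perp L|] times, and [c] compensates for this. *)
pose c : R := Num.sqrt (#|L|%:R / #|V|%:R).
have V0 : (0 < #|V|)%N by rewrite card_V // muln_gt0 expn_gt0 prime_gt0.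
have c2 : (toC c)^* * toC c = #|L|%:R / #|V|%:R.
  rewrite toC_conj !toC_real.
  rewrite -rmorphM /= -expr2 sqr_sqrtr ?divr_ge0 //.
  by rewrite rmorphM fmorphV /= !rmorph_nat.
pose Q x : op R (qidx d n) := toC c *: (Pi *m adj (N (r x))).
pose Rk (i : 'I_#|V|) := Q (enum_val i).
have sumV (U : nmodType) (f : V -> U) : \sum_(i < #|V|) f (enum_val i) = \sum_x f x.
  by rewrite [RHS](reindex (@enum_val V predT)) //; apply: onW_bij; exact: enum_val_bij.
(* Since [r x - x] lies in [perp L], replacing [r x] by [x] does not change the conjugate of [Pi];
   the twirl then gives the identity. *)
have tQ : trace_preserving Rk.
  rewrite /trace_preserving /Rk (sumV _ (fun x => adj (Q x) *m Q x)).
  transitivity (\sum_x (#|L|%:R / #|V|%:R) *: (N x *m Pi *m adj (N x)) : op R (qidx d n)).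
    apply: eq_bigr => x _; rewrite /Q hadjZ -scalemxAl -scalemxAr scalerA c2; congr (_ *: _).
    rewrite hadjM hadjK PiA mulmxA -(mulmxA (N (r x))) PiI.
    have [a aa ->] := Nx_ratio x (r x).
    rewrite hadjZ -!scalemxAl -!scalemxAr scalerA mulrC aa scale1r hadjM.
    set z := r x - x.
    have -> : N x *m N z *m Pi *m (adj (N z) *m adj (N x)) = N x *m (N z *m Pi *m adj (N z)) *m adj (N x).
      by rewrite !mulmxA.
    by rewrite PiC ?r_coset // -(mulmxA Pi) Nx_unitaryV // mulmx1.
  rewrite -scaler_sumr PiT.
  rewrite -mul_scalar_mx -scalar_mxM mulrA divfK ?divff //.
    by rewrite pnatr_eq0 -lt0n zgroup_card_gt0.
  by rewrite pnatr_eq0 -lt0n.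
apply: ereal_sup_ge; exists (min_fidelity omega P Cs Rk)%:E.
  exists Cs, #|V|, Rk; split=> //.
  apply: (@le_trans _ _ (powR d%:R K%:R)); first by rewrite ler_powR // ler1n prime_gt0.
  by rewrite powR_mulrn // -natrX ler_nat -rk fixedSpace_dim_ge.
have dC : (0 < \dim Cs)%N.
  by apply: leq_trans (fixedSpace_dim_ge PiI); rewrite rk expn_gt0 prime_gt0.
rewrite lee_fin; apply: lb_le_inf.
  by have [psi [pC p1]] := exists_unit_vector dC; eexists; exists psi.
move=> _ [psi [pC p1] <-].
have pPi : adj psi *m Pi = adj psi by rewrite -{1}PiA -hadjM CsP.
have peig l : l \in L -> N l *m psi = tau l *: psi.
  by move=> lL; rewrite -(CsP _ pC) mulmxA PiE // -scalemxAl.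
suff h : (\sum_(x | x - r x \in L) Pn P x)%:C%C <= (adj psi *m
       kraus Rk (kraus (@chanK R d omega P n) (psi *m adj psi)) *m psi) 0 0 by exact: (Re_le h).
rewrite fidelityE.
rewrite (sumV _ (fun x => \sum_j (adj psi *m (Q x *m chanK omega P j *m psi)) 0 0 * ((adj psi *m (Q x *m chanK omega P j *m psi)) 0 0)^*)).
rewrite exchange_big /= rmorph_sum [leLHS]big_mkcond /=; apply: ler_sum => z _.
case: ifP => [zL|_]; last by apply: sumr_ge0 => x _; exact: mul_conjC_ge0.
have term x : x - z \in perp L -> (adj psi *m (Q x *m chanK omega P z *m psi)) 0 0
   * ((adj psi *m (Q x *m chanK omega P z *m psi)) 0 0)^* = #|L|%:R / #|V|%:R * (Pn P z)%:C%C.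
  move=> xz; rewrite /Q /chanK (r_const xz).
  have [a aa ->] := Nx_ratio (r z) z.
  have -> : adj psi *m (toC c *: (Pi *m adj (N (r z))) *m (toC (Num.sqrt (Pn P z)) *: (a *: (N (r z) *m N (z - r z)))) *m psi)
     = (toC c * toC (Num.sqrt (Pn P z)) * a * tau (z - r z)) *: (adj psi *m psi).
    rewrite -!scalemxAl -!scalemxAr -!scalemxAl -!scalemxAr !scalerA.
    have -> : adj psi *m (Pi *m adj (N (r z)) *m (N (r z) *m N (z - r z)) *m psi)
        = (adj psi *m Pi) *m ((adj (N (r z)) *m N (r z)) *m (N (z - r z) *m psi)).
      by rewrite !mulmxA.
    by rewrite pPi Nx_unitary // mul1mx peig // -scalemxAr scalerA.
  rewrite mxE p1 mulr1 !rmorphM /= mulrACA [X in _ * X]mulrC (tau_conj d_prime omega_prim psi00 psi0e) // mulr1.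
  rewrite mulrACA [X in _ * X]mulrC aa mulr1 mulrACA [X in X * _]mulrC [X in _ * X]mulrC.
  by rewrite c2 toC_sqrt_sq.
(* Only the [x] with the syndrome of [z] are kept. There are [#|perp L|] of them, and their equal
   contributions add up to the probability of [z]. *)
rewrite (bigID (fun x => x - z \in perp L)) /= -[leLHS]addr0 lerD //; last first.
  by apply: sumr_ge0 => x _; exact: mul_conjC_ge0.
rewrite (eq_bigr _ term) (reindex_inj (addrI z)) /=.
rewrite (eq_bigl (mem (perp L))) => [|y /=]; last by rewrite addrAC subrr add0r.
rewrite sumr_const.
rewrite -[leRHS]mulr_natl mulrA mulrA -natrM mulnC (card_perp d_prime omega_prim) // divff ?mul1r //.
by rewrite pnatr_eq0 -lt0n.
Qed.

End StabilizerCode.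
End PauliChannel.

(** * Random coding *)

Section RandomCoding.
Variables (R : realType) (d : nat) (omega : R[i]) (P : 'F_d * 'F_d -> R).
Hypothesis d_prime : prime d.
Hypothesis omega_prim : d.-primitive_root omega.
Hypothesis P_ge0 : forall u, 0 <= P u.
Hypothesis P_sum1 : \sum_u P u = 1.
Variable n : nat.
Local Notation V := ('M['F_d]_(n, 2)).
Local Notation p := (@Pn R d P n).

Definition coset_prob (M : {set V}) (x : V) : R := \sum_(l in M) p (x + l).

Lemma coset_prob_ge0 M x : 0 <= coset_prob M x.
Proof. by apply: sumr_ge0 => l _; exact: Pn_ge0. Qed.

Lemma coset_prob_ge M x : zgroup M -> p x <= coset_prob M x.
Proof.
move=> gM; rewrite /coset_prob (bigD1 0) ?zgroup0 //= addr0 lerDl.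
by apply: sumr_ge0 => l _; exact: Pn_ge0.
Qed.

Lemma coset_prob_shift M x l : zgroup M -> l \in M ->
  coset_prob M (x + l) = coset_prob M x.
Proof.
move=> gM lM; rewrite /coset_prob [RHS](reindex_inj (addrI l)) /=; apply: eq_big => y.
  by rewrite zgroup_addl.
by rewrite addrA.
Qed.

Section OneShot.
Variables (M : {set V}) (k a : nat) (B : R).
Hypothesis gM : zgroup M.
Hypothesis iM : M \subset perp M.
Hypothesis cardM : (#|M| * d ^ k = d ^ n)%N.
Hypothesis a_le : (a <= k)%N.
Hypothesis B_ge0 : 0 <= B.

(** For positive [B]: the coset of [x] modulo [M] has conditional probability at least [1 / B] given
    the syndrome. The product form also covers syndromes of probability zero. *)
Definition typical (x : V) := coset_prob (perp M) x <= B * coset_prob M x.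

Lemma typical_shift x l : l \in M -> typical (x + l) = typical x.
Proof.
move=> lM; rewrite /typical !coset_prob_shift ?perp_zgroup //.
exact: (fintype.subsetP iM).
Qed.

(** The probability that shifting the error by [z] gives a typical competitor, divided by [#|M|] so
    that a whole coset of competitors modulo [M] counts once. *)
Definition confusion_weight (z : V) : R := \sum_x p x * ((typical (x + z))%:R / #|M|%:R).

Lemma confusion_weight_ge0 z : 0 <= confusion_weight z.
Proof.
by apply: sumr_ge0 => x _; rewrite mulr_ge0 ?Pn_ge0 // divr_ge0.
Qed.

Let cM : 0 < #|M|%:R :> R.
Proof. by rewrite ltr0n zgroup_card_gt0. Qed.

(** Given the syndrome, each typical coset modulo [M] carries at least a fraction [1 / B] of the
    probability, so there are at most [B] of them. *)
Lemma confusion_weight_sum : \sum_(z in perp M) confusion_weight z <= B.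
Proof.
rewrite exchange_big /= -[leRHS]mul1r -[X in _ <= X * _](Pn_sum1 P_sum1 n) mulr_suml.
apply: ler_sum => x _.
have [p0|p0] := eqVneq (p x) 0; first by rewrite p0 !mul0r big1 // => z _; rewrite mul0r.
rewrite -mulr_sumr ler_wpM2l ?Pn_ge0 //.
have G0 : 0 < coset_prob (perp M) x.
  by apply: lt_le_trans (coset_prob_ge x (perp_zgroup M)); rewrite lt_neqAle eq_sym p0 Pn_ge0.
rewrite -mulr_suml ler_pdivrMr //.
have h z : z \in perp M -> (typical (x + z))%:R <= B * coset_prob M (x + z) / coset_prob (perp M) x.
  move=> zp; rewrite ler_pdivlMr //.
  have [t|_] := boolP (typical _); last by rewrite mul0r mulr_ge0 ?coset_prob_ge0.
  by move: t; rewrite /typical mul1r (coset_prob_shift _ (perp_zgroup M)).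
apply: (le_trans (ler_sum _ h)); rewrite -mulr_suml -mulr_sumr ler_pdivrMr // -mulrA ler_wpM2l //.
(* Each of the [#|M|] shifts [l] permutes [perp M], so each contributes the full probability of the
   syndrome. *)
rewrite /coset_prob exchange_big /= mulr_natl -sumr_const; apply: ler_sum => l lM.
have lp : l \in perp M by exact: (fintype.subsetP iM).
rewrite [leRHS](reindex_inj (addrI l)) /= le_eqVlt; apply/orP; left; apply/eqP.
apply: eq_big => z; first by rewrite zgroup_addl // perp_zgroup.
by rewrite -addrA [z + l]addrC.
Qed.

Lemma Fstar_ge_random_coding (kk : R) : kk <= (k - a)%:R ->
  ((1 - (\sum_(x | ~~ typical x) p x + B / (d ^ a)%:R))%:E <= Fstar omega P n kk)%E.
Proof.
move=> kkk.
have da0 : 0 < (d ^ a)%:R :> R by rewrite ltr0n expn_gt0 prime_gt0.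
have [|L [gL iL sL cL hL]] := isotropic_tower d_prime omega_prim (a := a) confusion_weight_ge0 gM iM.
  by rewrite -cardM leq_mul2l leq_exp2l ?prime_gt1 // a_le orbT.
pose cls x : {set V} := [set y | y - x \in perp L].
have clsE x y : (y \in cls x) = (y - x \in perp L) by rewrite inE.
(* Decode to a typical error with the observed syndrome if there is one, otherwise to any error with
   it. The default 0 never occurs, as [x] is in [cls x]; and [r] depends on [x] only through
   [cls x]. *)
pose r x := if [pick y in cls x | typical y] is Some y then y else
  if [pick y in cls x] is Some y then y else 0.
have gp := perp_zgroup L.
have r_cls x : r x \in cls x.
  rewrite /r; case: pickP => [y /andP [] //|_]; case: pickP => [//|/(_ x)] /=.
  by rewrite inE subrr zgroup0.
have r_typ x : typical x -> typical (r x).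
  rewrite /r => tx; case: pickP => [y /andP [] //|/(_ x)] /=.
  by rewrite inE subrr zgroup0 //= tx.
have r_coset x : r x - x \in perp L by have := r_cls x; rewrite inE.
have r_const x y : x - y \in perp L -> r x = r y.
  move=> xy; rewrite /r (_ : cls x = cls y) //; apply/finset.setP => z; rewrite !clsE.
  by rewrite -(zgroup_addr (z - x) gp xy) addrA subrK.
have cardL : (#|L| * d ^ (k - a) = d ^ n)%N by rewrite cL -mulnA -expnD subnKC.
apply: le_trans (Fstar_ge_stabilizer d_prime omega_prim P_ge0 gL iL cardL r_coset r_const kkk).
rewrite lee_fin lerBlDr -[X in X <= _](Pn_sum1 P_sum1 n) (bigID (fun x => x - r x \in L)) /= lerD2l.
apply: (@le_trans _ _ (\sum_(x | ~~ typical x) p x + \sum_(z in perp L :\: L) confusion_weight z)); last first.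
  rewrite lerD2l ler_pdivlMr // mulrC (le_trans hL) //.
  apply: le_trans confusion_weight_sum; rewrite [leLHS]big_mkcond [leRHS]big_mkcond; apply: ler_sum => z _.
  by rewrite finset.in_setD andbC; case: (z \in perp M) => //=; case: ifP => // _; exact: confusion_weight_ge0.
(* The comparison is made separately for each error [x]: a decoding failure requires [x] to be
   atypical or to have a typical competitor. *)
rewrite exchange_big /= [leLHS]big_mkcond [X in _ <= X + _]big_mkcond -big_split /=.
apply: ler_sum => x _; rewrite -mulr_sumr.
have s0 : 0 <= \sum_(z in perp L :\: L) ((typical (x + z))%:R / #|M|%:R : R).
  by apply: sumr_ge0 => z _; rewrite divr_ge0.
case: ifP => xL; last by rewrite addr_ge0 ?mulr_ge0 ?Pn_ge0 //; case: ifP; rewrite ?Pn_ge0.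
case: ifP => [_|/negbFE tx]; first by rewrite lerDl mulr_ge0 ?Pn_ge0.
rewrite add0r ler_peMr ?Pn_ge0 // -mulr_suml ler_pdivlMr // mul1r.
set z0 := r x - x.
have z0n : z0 \notin L by rewrite /z0 zgroup_subC // xL.
(* For a typical [x] decoded wrongly, all of [z0 + M] consists of undetected shifts to typical
   errors; after division by [#|M|] these already count 1. *)
apply: (@le_trans _ _ (\sum_(l in M) 1)); first by rewrite sumr_const.
rewrite [leRHS](reindex_inj (addrI z0)) /= [leLHS]big_mkcond [leRHS]big_mkcond; apply: ler_sum => l _.
case: ifP => [lM|_]; last by case: ifP.
have lL := fintype.subsetP sL l lM.
rewrite finset.in_setD (zgroup_addr _ gL) // z0n /= (zgroup_addr _ gp) ?r_coset; last exact: (fintype.subsetP iL).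
by rewrite addrA typical_shift // /z0 addrC subrK r_typ.
Qed.

End OneShot.
End RandomCoding.

(** * Splitting [m * n] qudits into [m] independent blocks *)

Section Blocks.
Variables (R : realType) (d : nat) (P : 'F_d * 'F_d -> R).
Variables (m n : nat).
Local Notation V := ('M['F_d]_(m * n, 2)).
Local Notation W := ('M['F_d]_(n, 2)).

Definition block (j : 'I_m) (x : V) : W := \matrix_(i, l) x (mxvec_index j i) l.

(** Position [i] of block [j] is qudit [mxvec_index j i], so [mxvec], applied to each of the two
    columns, inverts [block]. *)
Definition unblock (h : {ffun 'I_m -> W}) : V :=
  \matrix_(k, l) mxvec (\matrix_(j < m, i < n) h j i l) 0 k.

Lemma blockK j h : block j (unblock h) = h j.
Proof. by apply/matrixP => i l; rewrite !mxE mxvecE mxE. Qed.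

Lemma unblockK x : unblock [ffun j => block j x] = x.
Proof.
apply/matrixP => k l; case/mxvec_indexP: k => j i.
by rewrite mxE mxvecE mxE ffunE mxE.
Qed.

Lemma blockD j x y : block j (x + y) = block j x + block j y.
Proof. by apply/matrixP => i l; rewrite !mxE. Qed.

Lemma blockB j x y : block j (x - y) = block j x - block j y.
Proof. by apply/matrixP => i l; rewrite !mxE. Qed.

Lemma block0 j : block j 0 = 0.
Proof. by apply/matrixP => i l; rewrite !mxE. Qed.

Lemma big_blocks (T : Type) (idx : T) (op : Monoid.com_law idx) (f : 'I_(m * n) -> T) :
  \big[op/idx]_k f k = \big[op/idx]_j \big[op/idx]_i f (mxvec_index j i).
Proof.
rewrite (reindex _ (curry_mxvec_bij _ _)) /=.
by rewrite pair_bigA; apply: eq_bigr => -[i j] _.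
Qed.

Lemma Pn_blocks x : Pn P x = \prod_j Pn P (block j x).
Proof.
rewrite /Pn big_blocks; apply: eq_bigr => j _; apply: eq_bigr => i _.
by rewrite !mxE.
Qed.

Lemma symp_blocks x y : symp x y = \sum_j symp (block j x) (block j y).
Proof.
rewrite /symp big_blocks; apply: eq_bigr => j _; apply: eq_bigr => i _.
by rewrite !mxE.
Qed.

Lemma sum_blocks (f : 'I_m -> W -> R) :
  \sum_(x : V) \prod_j f j (block j x) = \prod_j \sum_w f j w.
Proof.
rewrite (bigA_distr_bigA f) (reindex unblock) /=.
  by apply: eq_bigr => h _; apply: eq_bigr => j _; rewrite blockK.
exists (fun x => [ffun j => block j x]) => [h|x] _; last exact: unblockK.
by apply/ffunP => j; rewrite ffunE blockK.
Qed.

Definition block_set (L : {set W}) : {set V} := [set x | [forall j, block j x \in L]].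

Lemma block_setP (L : {set W}) x : reflect (forall j, block j x \in L) (x \in block_set L).
Proof. by rewrite inE; exact: forallP. Qed.

Lemma block_set_zgroup L : zgroup L -> zgroup (block_set L).
Proof.
move=> gL; apply: zgroupI => [|x y /block_setP hx /block_setP hy]; apply/block_setP => j.
  by rewrite block0 zgroup0.
by rewrite blockB zgroupB.
Qed.

Lemma perp_block_set L : zgroup L -> perp (block_set L) = block_set (perp L).
Proof.
move=> gL; apply/finset.setP => y; apply/perpP/block_setP => h.
  move=> j; apply/perpP => l lL.
  (* Test against the vector that is [l] in block [j] and zero elsewhere. *)
  have := h (unblock [ffun j' => if j' == j then l else 0]).
  rewrite symp_blocks (bigD1 j) //= big1 => [|i /negPf ij].
    rewrite blockK ffunE eqxx addr0; apply; apply/block_setP => j'.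
    by rewrite blockK ffunE; case: ifP; rewrite ?zgroup0.
  by rewrite blockK ffunE ij symp_anti symp0r oppr0.
move=> x /block_setP hx; rewrite symp_blocks big1 // => j _.
by apply: (perpP _ _ (h j)).
Qed.

Lemma block_set_isotropic L : zgroup L -> L \subset perp L ->
  block_set L \subset perp (block_set L).
Proof.
move=> gL /fintype.subsetP iL; rewrite perp_block_set //; apply/fintype.subsetP => x /block_setP h.
by apply/block_setP => j; apply: iL.
Qed.

Lemma prodr_nat (I : finType) (b : pred I) : \prod_i (b i)%:R = [forall i, b i]%:R :> R.
Proof.
have [/forallP h|/forallPn [i bi]] := boolP [forall i, b i].
  by rewrite big1 // => i _; rewrite h.
by rewrite (bigD1 i) //= (negPf bi) mul0r.
Qed.

Lemma coset_prob_blocks L x :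
  coset_prob P (block_set L) x = \prod_j coset_prob P L (block j x).
Proof.
rewrite /coset_prob.
transitivity (\sum_(l : V) \prod_j ((block j l \in L)%:R * Pn P (block j x + block j l))).
  rewrite big_mkcond; apply: eq_bigr => l _; rewrite big_split /= prodr_nat inE.
  rewrite Pn_blocks; case: ifP => _; last by rewrite mul0r.
  by rewrite mul1r; apply: eq_bigr => j _; rewrite blockD.
rewrite (sum_blocks (fun j w => (w \in L)%:R * Pn P (block j x + w))); apply: eq_bigr => j _.
by rewrite [RHS]big_mkcond; apply: eq_bigr => w _; case: ifP; rewrite ?mul1r ?mul0r.
Qed.

Lemma card_block_set L : (#|block_set L| = #|L| ^ m)%N.
Proof.
(* Counting in [R] turns membership into a product of indicators, to which [sum_blocks] applies. *)
apply/eqP; rewrite -(eqr_nat R) natrX -sum1_card natr_sum.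
have -> : \sum_(x in block_set L) 1%:R = \sum_(x : V) \prod_j ((block j x \in L)%:R : R).
  by rewrite big_mkcond; apply: eq_bigr => x _; rewrite prodr_nat inE; case: ifP.
rewrite (sum_blocks (fun j w => (w \in L)%:R)) prodr_const card_ord; apply/eqP; congr (_ ^+ _).
by rewrite -sum1_card natr_sum [RHS]big_mkcond; apply: eq_bigr => w _; case: ifP.
Qed.

End Blocks.

(** * Entropy and purification *)

(* Both sides are the determinant of the block matrix [['X, A], [B, 1]],
   up to the triangular factors that clear one of its off-diagonal blocks. *)
Lemma char_poly_mulmxC (F : fieldType) (m n : nat) (A : 'M[F]_(n, m)) (B : 'M[F]_(m, n)) :
  'X^m * char_poly (A *m B) = 'X^n * char_poly (B *m A).
Proof.
pose a := map_mx polyC A; pose b := map_mx polyC B.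
pose M := block_mx ('X%:M : 'M_n) a b 1%:M.
have e1 : M *m block_mx 1%:M 0 (- b) 1%:M = block_mx ('X%:M - a *m b) a 0 1%:M.
  rewrite mulmx_block !mulmx1 !mulmx0 !mul1mx mulmxN ?add0r ?addr0 subrr.
  by [].
have e2 : block_mx 1%:M 0 (- b) 'X%:M *m M = block_mx 'X%:M a 0 ('X%:M - b *m a).
  rewrite mulmx_block !mul1mx !mul0mx !mulNmx !addr0 mulmx1.
  by rewrite mul_mx_scalar mul_scalar_mx addNr [- _ + _]addrC.
have d1 : \det M = char_poly (A *m B).
  have := congr1 determinant e1; rewrite det_mulmx det_lblock det_ublock !det1 !mulr1.
  by move=> ->; rewrite /char_poly /char_poly_mx map_mxM.
have := congr1 determinant e2; rewrite det_mulmx det_lblock det_ublock !det1 mul1r.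
rewrite !det_scalar d1 => ->; congr (_ * _).
by rewrite /char_poly /char_poly_mx map_mxM.
Qed.

Section Entropy.
Variables (R : realType) (d : nat).
Local Notation C := (R[i]).

Lemma etaf0 : etaf d (0 : R) = 0.
Proof. by rewrite /etaf ltxx. Qed.

Lemma etafE (x : R) : 0 <= x -> etaf d x = - (x * ln x / ln d%:R).
Proof.
rewrite /etaf le_eqVlt => /predU1P [<-|->]; last by [].
by rewrite ltxx !mul0r oppr0.
Qed.

(** By [char_poly_mulmxC], [A *m B] and [B *m A] have the same eigenvalues up to zeros, and zeros
    contribute nothing to the entropy. *)
Lemma vN_entropy_mulmx (T : finType) m (A : 'M[C]_(#|T|, m)) (B : 'M[C]_(m, #|T|))
    (lam : 'I_m -> R) :
  B *m A = diag_mx (\row_i (lam i)%:C%C) ->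
  vN_entropy d (A *m B : op R T) = \sum_i etaf d (lam i).
Proof.
move=> BA; rewrite /vN_entropy; case: closed_field_poly_normal => s /= hs.
rewrite (monicP (char_poly_monic _)) scale1r in hs.
have := char_poly_mulmxC A B; rewrite hs BA char_poly_trig; last by rewrite diag_mx_is_trig.
(* Powers of ['X] are written as linear factors with root 0, so that the two root lists can be
   compared up to permutation. *)
have X0 k : 'X^k = \prod_(z <- nseq k (0 : C)) ('X - z%:P).
  by elim: k => [|k IH]; rewrite /= ?big_nil ?expr0 // big_cons -IH subr0 exprS.
have -> : \prod_(i < m) ('X - (diag_mx (\row_i0 (lam i0)%:C%C) i i)%:P)
   = \prod_(z <- [seq (lam i)%:C%C | i <- index_enum 'I_m]) ('X - z%:P) :> {poly C}.
  by rewrite big_map; apply: eq_bigr => i _; rewrite !mxE eqxx.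
rewrite !X0 -!big_cat => /prod_XsubC_eq pe.
have : \sum_(z <- nseq m 0 ++ s) etaf d (complex.Re z) =
  \sum_(z <- nseq #|T| 0 ++ [seq (lam i)%:C%C | i <- index_enum 'I_m]) etaf d (complex.Re z).
  exact: perm_big.
rewrite !big_cat /= !big_nseq big_map /=.
have i0 k : iter k (+%R (etaf d (0 : R))) 0 = 0 by elim: k => //= k ->; rewrite etaf0 addr0.
by rewrite !i0 !add0r.
Qed.

(** Packing the columns [A i] and the rows [B i] into two matrices makes the product in reverse
    order diagonal. The family [A] carries the eigenvalues; [B] plays the dual vectors. *)
Lemma vN_entropy_sum (T I : finType) (A : I -> 'cV[C]_#|T|) (B : I -> 'rV[C]_#|T|)
    (lam : I -> R) :
  (forall i j, (B i *m A j) 0 0 = ((i == j)%:R * lam i)%:C%C) ->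
  vN_entropy d (\sum_i A i *m B i : op R T) = \sum_i etaf d (lam i).
Proof.
move=> h.
have sumI (U : nmodType) (f : I -> U) : \sum_(i < #|I|) f (enum_val i) = \sum_x f x.
  by rewrite [RHS](reindex (@enum_val I predT)) //; apply: onW_bij; exact: enum_val_bij.
rewrite -sumI -[RHS]sumI.
pose A' : 'M[C]_(#|T|, #|I|) := \matrix_(k, i) A (enum_val i) k 0.
pose B' : 'M[C]_(#|I|, #|T|) := \matrix_(i, k) B (enum_val i) 0 k.
have -> : \sum_(i < #|I|) A (enum_val i) *m B (enum_val i) = A' *m B'.
  apply/matrixP => k l; rewrite summxE mxE; apply: eq_bigr => i _.
  by rewrite !mxE big_ord1.
apply: vN_entropy_mulmx; apply/matrixP => i j.
have := h (enum_val i) (enum_val j); rewrite (inj_eq enum_val_inj) !mxE => e.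
rewrite (_ : \sum__ _ = \sum_k B (enum_val i) 0 k * A (enum_val j) k 0); last first.
  by apply: eq_bigr => k _; rewrite !mxE.
rewrite e; case: eqP => [->|_]; rewrite ?mul1r ?mul0r ?mulr1n ?mulr0n //.
Qed.

End Entropy.

Section Purification.
Variables (R : realType) (T : finType).
Local Notation C := (R[i]).

(** A bipartite vector read as a matrix, system index as row and reference index as column. Inner
    products become Hilbert-Schmidt products, the reduced state becomes [A A^*], and operators on
    the system act by left multiplication. *)
Definition vec_op (v : vec R (T * T)%type) : op R T :=
  mkop (fun i r => v (enum_rank (r, i)) 0).

Lemma vec_op_inner (u v : vec R (T * T)%type) :
  (adj u *m v) 0 0 = \tr (adj (vec_op u) *m vec_op v).
Proof.
rewrite /vec_op mkop_adj mkopM mkop_tr mxE.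
rewrite (reindex (@enum_rank (T * T)%type)) /=; last by apply: onW_bij; exact: enum_rank_bij.
rewrite pair_bigA /=.
by apply: eq_bigr => -[r i] _; rewrite !mxE.
Qed.

Lemma vec_op_inj : injective vec_op.
Proof.
move=> u v e; apply/matrixP => k l; rewrite (ord1 l) -(enum_valK k).
case: (enum_val k) => r i.
by have := congr1 (fun A => ent A i r) e; rewrite !ent_mkop.
Qed.

Lemma vec_opZ a v : vec_op (a *: v) = a *: vec_op v.
Proof. by apply/matrixP => i j; rewrite !mxE. Qed.

Lemma vec_op_liftR (K : op R T) v : vec_op (liftR K *m v) = K *m vec_op v.
Proof.
rewrite -[K in RHS]entK /vec_op mkopM; apply: eq_mkop => i r.
rewrite mxE (reindex (@enum_rank (T * T)%type)) /=; last by apply: onW_bij; exact: enum_rank_bij.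
transitivity (\sum_r' \sum_i' liftR K (enum_rank (r, i)) (enum_rank (r', i')) * v (enum_rank (r', i')) 0).
  by rewrite pair_bigA; apply: eq_bigr => -[].
rewrite (bigD1 r) //= [X in _ + X]big1 ?addr0 => [|r' /negPf rr'].
  apply: eq_bigr => i' _; congr (_ * _).
  by rewrite -[LHS]/(ent (liftR K) (r, i) (r, i')) ent_mkop /= eqxx mul1r.
apply: big1 => i' _.
by rewrite -[X in X * _]/(ent (liftR K) (r, i) (r', i')) ent_mkop /= eq_sym rr' !mul0r.
Qed.

Lemma ptrR_vec_op v : ptrR (v *m adj v) = vec_op v *m adj (vec_op v).
Proof.
rewrite /ptrR /vec_op mkop_adj mkopM; apply: eq_mkop => i j.
by apply: eq_bigr => r _; rewrite /ent !mxE big_ord1 !mxE.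
Qed.

Lemma purifP (A : op R T) : ptrR (purif (A *m adj A) *m adj (purif (A *m adj A))) = A *m adj A.
Proof.
apply: (ClassicalEpsilon.epsilon_spec (inhabits (0 : vec R (T * T)%type))
  (fun Psi => ptrR (Psi *m adj Psi) = A *m adj A)).
(* The matrix [A] itself, read as a bipartite vector, is a purification. *)
exists (\col_k A (enum_rank (enum_val k).2) (enum_rank (enum_val k).1)).
rewrite ptrR_vec_op; set B := vec_op _; suff -> : B = A by [].
by apply/matrixP => i j; rewrite !mxE !enum_rankK /= !enum_valK.
Qed.

End Purification.

(** * Coherent information of stabilizer codes *)

Section CohInfo.
Variables (R : realType) (d : nat) (omega : R[i]) (P : 'F_d * 'F_d -> R).
Hypothesis d_prime : prime d.
Hypothesis omega_prim : d.-primitive_root omega.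
Hypothesis P_ge0 : forall u, 0 <= P u.
Hypothesis P_sum1 : \sum_u P u = 1.
Variable n : nat.
Local Notation C := (R[i]).
Local Notation V := ('M['F_d]_(n, 2)).
Local Notation N := (@Nx R d omega n).
Local Notation D := #|qidx d n|.
Local Notation p := (@Pn R d P n).
Local Notation coset_prob := (@coset_prob R d P n).

Definition coset_rep (G : {set V}) (x : V) : V :=
  odflt 0 [pick y in [set y : V | y - x \in G]].

Lemma coset_rep_mem G x : zgroup G -> coset_rep G x - x \in G.
Proof.
move=> gG; rewrite /coset_rep; case: pickP => [y /=|/(_ x)]; first by rewrite inE.
by rewrite /= inE subrr zgroup0.
Qed.

Lemma coset_rep_const G x y : zgroup G -> x - y \in G -> coset_rep G x = coset_rep G y.
Proof.
move=> gG xy; rewrite /coset_rep.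
suff -> : [set z : V | z - x \in G] = [set z : V | z - y \in G] by [].
by apply/finset.setP => z; rewrite !inE -(zgroup_addr (z - x) gG xy) addrA subrK.
Qed.

(** Group the terms by [coset_rep]. Its fixed points list each coset once, and zeros elsewhere keep
    the sum indexed by all of [V]. *)
Lemma sum_cosets (K : pzRingType) (U : lmodType K) (G : {set V}) (f : V -> K) (F : V -> U) :
  zgroup G -> (forall x y, x - y \in G -> F x = F y) ->
  \sum_x f x *: F x =
  \sum_s (if coset_rep G s == s then (\sum_(l in G) f (s + l)) *: F s else 0).
Proof.
move=> gG FG; rewrite (partition_big (coset_rep G) predT) //= ; apply: eq_bigr => s _.
case: eqP => [rs|rs]; last first.
  rewrite big1 // => x /eqP xs; case: rs; rewrite -xs; apply: coset_rep_const => //.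
  exact: coset_rep_mem.
rewrite scaler_suml [LHS](reindex_inj (addrI s)) /=; apply: eq_big => l.
  apply/eqP/idP => [e|lG].
    have := coset_rep_mem (s + l) gG; rewrite e opprD addrA subrr sub0r => /(zgroupN gG).
    by rewrite opprK.
  by rewrite (@coset_rep_const _ _ s) // addrAC subrr add0r.
move=> /eqP e; congr (_ *: _); apply: FG.
by have := coset_rep_mem (s + l) gG; rewrite e zgroup_subC.
Qed.

Lemma coset_prob_eq G x y : zgroup G -> x - y \in G -> coset_prob G x = coset_prob G y.
Proof.
by move=> gG xy; rewrite -[x](subrK y) addrC coset_prob_shift.
Qed.

Lemma sum_etaf_cosets G : zgroup G ->
  \sum_s (if coset_rep G s == s then etaf d (coset_prob G s) else 0) =
  - (\sum_x p x * ln (coset_prob G x) / ln d%:R).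
Proof.
move=> gG; rewrite -mulr_suml.
have -> : \sum_x p x * ln (coset_prob G x) = \sum_x p x *: (ln (coset_prob G x) : R^o) by [].
rewrite (sum_cosets _ gG) => [|x y xy]; last by rewrite (coset_prob_eq gG xy).
rewrite mulr_suml -sumrN; apply: eq_bigr => s _; case: ifP => _; last by rewrite mul0r oppr0.
by rewrite etafE // coset_prob_ge0.
Qed.

Lemma toC_sum (I : finType) (Q : pred I) (f : I -> R) :
  (\sum_(i | Q i) f i)%:C%C = \sum_(i | Q i) (f i)%:C%C :> C.
Proof. exact: (rmorph_sum (@real_complex R)). Qed.

Section Code.
Variables (L : {set V}) (k : nat) (Pi : op R (qidx d n)) (tau : V -> C).
Hypothesis gL : zgroup L.
Hypothesis Pi_idem : Pi *m Pi = Pi.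
Hypothesis Pi_adj : adj Pi = Pi.
Hypothesis Pi_eigen : forall x, x \in L -> N x *m Pi = tau x *: Pi.
Hypothesis tau_unit : forall x, x \in L -> (tau x)^* * tau x = 1.
Hypothesis Pi_comm : forall y, y \in perp L -> N y *m Pi = Pi *m N y.
Hypothesis Pi_orth : forall y, y \notin perp L -> Pi *m N y *m Pi = 0.
Hypothesis Pi_tr0 : forall y, y \notin L -> \tr (N y *m Pi) = 0.
Hypothesis Pi_tr : \tr Pi = (d ^ k)%:R.

Let rho : op R (qidx d n) := (d ^ k)%:R^-1 *: Pi.

Let dk0 : (d ^ k)%:R != 0 :> C.
Proof. by rewrite pnatr_eq0 -lt0n expn_gt0 prime_gt0. Qed.

Let dkR : 0 < (d ^ k)%:R :> R.
Proof. by rewrite ltr0n expn_gt0 prime_gt0. Qed.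

Lemma Nx_ratioV x y : exists2 a, a^* * a = 1 & adj (N x) *m N y = a *: N (y - x).
Proof.
have [a aa ->] := Nx_ratio d_prime omega_prim x y.
by exists a => //; rewrite -scalemxAr mulmxA Nx_unitary // mul1mx.
Qed.

Let A_prob x A : chanK omega P x *m A *m adj (chanK omega P x) = (p x)%:C%C *: (N x *m A *m adj (N x)).
Proof.
rewrite /chanK hadjZ -!scalemxAl -!scalemxAr scalerA [X in X *: _]mulrC.
by rewrite toC_sqrt_sq.
Qed.

Lemma syndrome_conj x y : x - y \in perp L -> N x *m Pi *m adj (N x) = N y *m Pi *m adj (N y).
Proof.
move=> xy; have [a aa ->] := Nx_ratio d_prime omega_prim y x.
rewrite hadjZ -!scalemxAl -!scalemxAr scalerA [X in X *: _]mulrC aa scale1r hadjM.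
set z := x - y.
have -> : N y *m N z *m Pi *m (adj (N z) *m adj (N y)) = N y *m (N z *m Pi *m adj (N z)) *m adj (N y).
  by rewrite !mulmxA.
by rewrite Pi_comm // -(mulmxA Pi) Nx_unitaryV // mulmx1.
Qed.

(** The output is a mixture, over syndromes [s], of normalised projections onto orthogonal subspaces
    of dimension [d ^ k]. Each [s] contributes [d ^ k] eigenvalues [g s], hence the entropy of the
    syndrome plus [k]. *)
Lemma entropy_output :
  vN_entropy d (kraus (@chanK R d omega P n) rho) =
  k%:R - \sum_x p x * ln (coset_prob (perp L) x) / ln d%:R.
Proof.
have gp := perp_zgroup L.
(* The columns of [cb] and the rows of [rb] are dual bases that split [Pi] into rank-one terms. *)
have [r [cb [rb [cr rc]]]] : exists r, exists cb : 'M[C]_(D, r), exists rb : 'M[C]_(r, D),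
    cb *m rb = Pi /\ rb *m cb = 1%:M.
  by exists (\rank Pi), (col_base Pi), (row_base Pi); rewrite mulmx_base idem_base.
have rk : r = (d ^ k)%N.
  by apply/eqP; rewrite -(eqr_nat C) -Pi_tr -cr mxtrace_mulC rc mxtrace1.
pose b s := coset_rep (perp L) s == s.
pose g s := coset_prob (perp L) s / (d ^ k)%:R.
pose lam (si : V * 'I_r) := if b si.1 then g si.1 else 0.
pose A (si : V * 'I_r) : 'cV[C]_D := (lam si)%:C%C *: (N si.1 *m col si.2 cb).
pose B (si : V * 'I_r) : 'rV[C]_D := (b si.1)%:R *: (row si.2 rb *m adj (N si.1)).
have -> : kraus (@chanK R d omega P n) rho = \sum_si A si *m B si.
  transitivity (\sum_x (p x)%:C%C *: ((d ^ k)%:R^-1 *: (N x *m Pi *m adj (N x)))).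
    apply: eq_bigr => x _; rewrite A_prob /rho -!scalemxAr -!scalemxAl.
    by [].
  rewrite (sum_cosets _ gp) => [|x y xy]; last by rewrite (syndrome_conj xy).
  rewrite -(pair_bigA _ (fun s i => A (s, i) *m B (s, i))) /=; apply: eq_bigr => s _.
  rewrite /A /B /lam /= -/(b s); case: ifP => bs; last first.
    by rewrite big1 // => i _; rewrite !scale0r mul0mx.
  transitivity (\sum_i (g s)%:C%C *: (N s *m (col i cb *m row i rb) *m adj (N s))); last first.
    by apply: eq_bigr => i _; rewrite scale1r -scalemxAl !mulmxA.
  rewrite -scaler_sumr -mulmx_suml -mulmx_sumr.
  have -> : \sum_i col i cb *m row i rb = Pi.
    rewrite -cr; apply/matrixP => i j; rewrite summxE [RHS]mxE; apply: eq_bigr => l _.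
    by rewrite mxE big_ord1 !mxE.
  rewrite scalerA; congr (_ *: _); rewrite /g rmorphM fmorphV rmorph_nat; congr (_ / _).
  by rewrite /= /coset_prob toC_sum.
rewrite (vN_entropy_sum d (lam := lam)).
  rewrite -(pair_bigA _ (fun s i => etaf d (lam (s, i)))) /=.
  transitivity (\sum_s (if b s then coset_prob (perp L) s * k%:R + etaf d (coset_prob (perp L) s) else 0)).
    apply: eq_bigr => s _; rewrite /lam /= sumr_const card_ord rk; case: ifP => _; last by rewrite etaf0 mul0rn.
    have [g0|g0] := eqVneq (coset_prob (perp L) s) 0.
      by rewrite /g g0 !mul0r etaf0 mul0rn addr0.
    have gp0 : 0 < coset_prob (perp L) s by rewrite lt_neqAle eq_sym g0 coset_prob_ge0.
    rewrite !etafE ?coset_prob_ge0 ?divr_ge0 ?coset_prob_ge0 //.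
    have ld : ln d%:R != 0 :> R by rewrite gt_eqF // ln_gt0 // ltr1n prime_gt1.
    have dR : (0 : R) < d%:R by rewrite ltr0n prime_gt0.
    have lg : ln (g s) = ln (coset_prob (perp L) s) - k%:R * ln d%:R.
      by rewrite /g ln_div ?posrE // natrX lnXn // mulr_natl.
    rewrite lg -[LHS]mulr_natr /g; move: (gt_eqF dkR).
    by move: ((d ^ k)%:R : R) => e /negbT e0; field; rewrite e0 ld.
  rewrite (eq_bigr (fun s => (if b s then coset_prob (perp L) s * k%:R else 0) + (if b s then etaf d (coset_prob (perp L) s) else 0))); last first.
    by move=> s _; case: ifP; rewrite ?addr0.
  rewrite big_split /= sum_etaf_cosets //; congr (_ - _).
  have := sum_cosets p gp (F := fun _ => (k%:R : R^o)) (fun _ _ _ => erefl).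
  rewrite -scaler_suml (Pn_sum1 P_sum1) scale1r => kE; rewrite [RHS]kE.
  by apply: eq_bigr.
move=> [s i] [s' i'].
rewrite /A /B -scalemxAl -scalemxAr scalerA mxE /lam /=.
have [bs|_] := boolP (b s); last by rewrite mulr0 !mul0r.
have [bs'|nbs'] := boolP (b s'); last first.
  rewrite mulr0 mul0r xpair_eqE; have [e|_] := eqVneq s s'; last by rewrite mul0r.
  by rewrite e (negPf nbs') in bs.
rewrite mul1r mulmxA.
have [e|ne] := eqVneq s s'.
  rewrite -e -(mulmxA (row i rb)) Nx_unitary // mulmx1 xpair_eqE eqxx /=.
  have -> : (row i rb *m col i' cb) 0 0 = (rb *m cb) i i'.
    by rewrite !mxE; apply: eq_bigr => l _; rewrite !mxE.
  by rewrite rc mxE; case: (i == i'); rewrite ?mulr1 ?mul1r ?mulr0 ?mul0r.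
rewrite xpair_eqE (negPf ne) mul0r.
have [a _] := Nx_ratioV s s'.
rewrite -(mulmxA (row i rb)) => ->.
have nzp : s' - s \notin perp L.
  apply: contra_neqN ne => ss; rewrite -(eqP bs) -(eqP bs') (coset_rep_const gp ss).
  by [].
(* Inserting [rb *m cb = 1] on both sides exposes [Pi N Pi], which vanishes for distinct
   syndromes. *)
have z0 : rb *m N (s' - s) *m cb = 0.
  rewrite -[rb]mul1mx -rc -(mulmxA rb) cr -[cb]mulmx1 -rc (mulmxA cb) cr.
  have -> : rb *m Pi *m N (s' - s) *m (Pi *m cb) = rb *m (Pi *m N (s' - s) *m Pi) *m cb by rewrite !mulmxA.
  by rewrite Pi_orth // mulmx0 mul0mx.
rewrite -scalemxAr -scalemxAl mxE.
have -> : (row i rb *m N (s' - s) *m col i' cb) 0 0 = (rb *m N (s' - s) *m cb) i i'.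
  by rewrite -row_mul !mxE; apply: eq_bigr => l _; rewrite !mxE.
by rewrite z0 mxE !mulr0.
Qed.

(** [1 - Pi] annihilates [A A^* = rho], hence annihilates [A]. This holds for every purification,
    including the one chosen by [purif]. *)
Lemma purif_fixed (Psi : vec R (qidx d n * qidx d n)%type) :
  vec_op Psi *m adj (vec_op Psi) = rho -> Pi *m vec_op Psi = vec_op Psi.
Proof.
set A := vec_op Psi => AA.
have : adj ((1%:M - Pi) *m A) = 0.
  apply: adjM_eq0; rewrite hadjK hadjM mulmxA -(mulmxA _ A) AA /rho.
  by rewrite -scalemxAr mulmxBl mul1mx Pi_idem subrr scaler0 mul0mx.
move/(congr1 (@adj R _ _)); rewrite hadjK mulmxBl mul1mx.
have -> : adj (0 : 'M[C]_D) = 0 by apply/matrixP => i j; rewrite !mxE rmorph0.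
by move/eqP; rewrite subr_eq0 => /eqP.
Qed.

(** The vectors obtained by applying [N x] to the system half of the purification are equal up to
    phase within a coset of [L], and orthonormal across cosets since [N y *m Pi] is traceless off
    [L]. The eigenvalues are thus the coset probabilities. *)
Lemma entropy_exchange :
  vN_entropy d (kraus (fun x => liftR (@chanK R d omega P n x)) (purif rho *m adj (purif rho))) =
  - \sum_x p x * ln (coset_prob L x) / ln d%:R.
Proof.
pose c : R := Num.sqrt (d ^ k)%:R^-1.
have rhoE : rho = (toC c *: Pi) *m adj (toC c *: Pi).
  rewrite hadjZ -scalemxAl -scalemxAr scalerA Pi_adj Pi_idem /rho; congr (_ *: _).
  rewrite toC_conj !toC_real -rmorphM /= -expr2 sqr_sqrtr ?invr_ge0 //.
  by rewrite fmorphV rmorph_nat.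
have := purifP (toC c *: Pi); rewrite -rhoE ptrR_vec_op; set Psi := purif rho => hP.
have PiPsi := purif_fixed hP.
pose v x : vec R (qidx d n * qidx d n)%type := liftR (N x) *m Psi.
have vE x : vec_op (v x) = N x *m vec_op Psi by exact: vec_op_liftR.
have inner x y : (adj (v x) *m v y) 0 0 = (d ^ k)%:R^-1 * \tr (adj (N x) *m N y *m Pi).
  rewrite vec_op_inner !vE hadjM.
  have -> : adj (vec_op Psi) *m adj (N x) *m (N y *m vec_op Psi)
      = adj (vec_op Psi) *m (adj (N x) *m N y *m vec_op Psi) by rewrite !mulmxA.
  by rewrite mxtrace_mulC -(mulmxA (adj (N x) *m N y)) hP /rho -scalemxAr mxtraceZ.
have vinv x y : x - y \in L -> v x *m adj (v x) = v y *m adj (v y).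
  move=> xy; have [a aa e] := Nx_ratio d_prime omega_prim y x.
  have -> : v x = (a * tau (x - y)) *: v y.
    apply: vec_op_inj; rewrite vec_opZ !vE e -PiPsi !mulmxA -!scalemxAl.
    rewrite -(mulmxA (N y)) Pi_eigen // -scalemxAr -scalemxAl scalerA.
    by [].
  rewrite hadjZ -scalemxAl -scalemxAr scalerA rmorphM /= mulrACA.
  by rewrite [a * _]mulrC aa [tau _ * _]mulrC tau_unit // mulr1 scale1r.
pose b s := coset_rep L s == s.
pose lam s := if b s then coset_prob L s else 0.
pose A (s : V) : vec R (qidx d n * qidx d n)%type := (lam s)%:C%C *: v s.
pose B (s : V) := (b s)%:R *: adj (v s).
have -> : kraus (fun x => liftR (@chanK R d omega P n x)) (Psi *m adj Psi) = \sum_s A s *m B s.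
  transitivity (\sum_x (p x)%:C%C *: (v x *m adj (v x))).
    apply: eq_bigr => x _.
    have -> : liftR (chanK omega P x) = toC (Num.sqrt (p x)) *: liftR (N x).
      rewrite /liftR -mkopZ; apply: eq_mkop => i j; rewrite /chanK /ent mxE.
      by rewrite mulrCA.
    rewrite hadjZ -!scalemxAl -!scalemxAr scalerA [X in X *: _]mulrC toC_sqrt_sq //.
    by rewrite /v hadjM !mulmxA.
  rewrite (sum_cosets _ gL) => [|x y xy]; last exact: vinv.
  apply: eq_bigr => s _; rewrite /A /B /lam /= -/(b s).
  case: ifP => bs; last by rewrite !scale0r mul0mx.
  by rewrite scale1r -scalemxAl /coset_prob toC_sum.
rewrite (vN_entropy_sum d (lam := lam)).
  rewrite -(sum_etaf_cosets gL); apply: eq_bigr => s _.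
  by rewrite /lam -/(b s); case: ifP; rewrite ?etaf0.
move=> s s'; rewrite /A /B -scalemxAl -scalemxAr scalerA mxE inner /lam.
have [bs|_] := boolP (b s); last by rewrite mulr0 !mul0r.
have [bs'|nbs'] := boolP (b s'); last first.
  rewrite mulr0 mul0r; have [e|_] := eqVneq s s'; last by rewrite mul0r.
  by rewrite e (negPf nbs') in bs.
rewrite mul1r; have [->|ne] := eqVneq s s'.
  by rewrite Nx_unitary // mul1mx Pi_tr mulVf // mulr1 mul1r.
have [a _ ->] := Nx_ratioV s s'.
rewrite -scalemxAl mxtraceZ Pi_tr0 ?mulr0 ?mul0r //.
apply: contra_neqN ne => ss; rewrite -(eqP bs) -(eqP bs').
by rewrite (coset_rep_const gL ss).
Qed.

Lemma coh_info_stabilizer :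
  coh_info d (@chanK R d omega P n) rho =
  k%:R - \sum_x p x * (ln (coset_prob (perp L) x) - ln (coset_prob L x)) / ln d%:R.
Proof.
rewrite /coh_info entropy_output entropy_exchange opprK -addrA; congr (_ + _).
rewrite addrC -sumrB -sumrN; apply: eq_bigr => x _.
by rewrite mulrBr mulrBl opprB.
Qed.

End Code.
End CohInfo.

(** * Achievable rates *)

Section Chernoff.
Variable R : realType.

(** From [1 - u <= expR (- u)] it suffices that the right side times [1 - u] is at least 1, and the
    excess is [u^2 (1 - 2 u)]. *)
Lemma expR_le_quadratic (u : R) : `|u| <= 1 / 2 -> expR u <= 1 + u + 2 * u ^+ 2.
Proof.
rewrite ler_norml => /andP [u1 u2].
have h := expR_ge1Dx (- u).
have : expR u * expR (- u) = 1 by rewrite -expRD subrr expR0.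
have := expR_gt0 u; move: (expR u) (expR (- u)) h => a b h a0 ab.
have h1 : a * (1 - u) <= 1 by rewrite -[leRHS]ab ler_wpM2l // ltW.
have h2 : 1 <= (1 + u + 2 * u ^+ 2) * (1 - u).
  have -> : (1 + u + 2 * u ^+ 2) * (1 - u) = 1 + u ^+ 2 * (1 - 2 * u) by ring.
  by rewrite lerDl mulr_ge0 ?sqr_ge0 //; lra.
rewrite -(ler_pM2r (_ : 0 < 1 - u)); last lra.
exact: le_trans h2.
Qed.

Lemma chernoff_base (W : finType) (p f : W -> R) :
  (forall w, 0 <= p w) -> \sum_w p w = 1 -> \sum_w p w * f w < 0 ->
  exists2 t, 0 <= t & \sum_w p w * expR (t * f w) < 1.
Proof.
move=> p0 p1 mu; set delta := - \sum_w p w * f w.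
have d0 : 0 < delta by rewrite oppr_gt0.
pose B := 1 + \sum_w `|f w|.
have fB w : `|f w| <= B.
  by rewrite /B (bigD1 w) //= addrCA lerDl addr_ge0 // sumr_ge0.
have B1 : 1 <= B by rewrite lerDl sumr_ge0.
have dB : delta <= B.
  rewrite /delta -sumrN -[B]mul1r -p1 mulr_suml; apply: ler_sum => w _.
  by rewrite -mulrN ler_wpM2l // (le_trans _ (fB w)) // -normrN ler_norm.
have B0 : 0 < B by lra.
(* With this [t] one has [t B <= 1/4], inside the range of the quadratic bound, and the second-order
   term is half of the first-order gain [t * delta]. *)
pose t := delta / (4 * B ^+ 2).
have t0 : 0 < t by rewrite divr_gt0 // mulr_gt0 ?exprn_gt0.
have tB : t * B ^+ 2 = delta / 4 by rewrite /t; field; rewrite gt_eqF.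
have tB2 : t * B <= 1 / 4.
  rewrite -(ler_pM2r B0) -mulrA -expr2 tB; lra.
exists t; first exact: ltW.
apply: (@le_lt_trans _ _ (\sum_w p w * (1 + t * f w + 2 * (t * B) ^+ 2))).
  apply: ler_sum => w _; rewrite ler_wpM2l //.
  have uB : `|t * f w| <= t * B by rewrite normrM (gtr0_norm t0) ler_wpM2l // ltW.
  apply: (le_trans (expR_le_quadratic _)); first by lra.
  move: uB; rewrite ler_norml => /andP [u1 u2].
  by rewrite lerD2l ler_wpM2l // -subr_ge0 subr_sqr mulr_ge0 //; lra.
have -> : \sum_w p w * (1 + t * f w + 2 * (t * B) ^+ 2) = 1 - t * delta + 2 * (t * B) ^+ 2.
  rewrite (eq_bigr (fun w => p w + t * (p w * f w) + p w * (2 * (t * B) ^+ 2))) => [|w _]; last by ring.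
  by rewrite !big_split /= -mulr_sumr -mulr_suml p1 /delta; ring.
have -> : 2 * (t * B) ^+ 2 = 2 * t * (t * B ^+ 2) by ring.
rewrite tB.
have : 0 < t * delta by rewrite mulr_gt0.
by lra.
Qed.

Lemma expR_small (c s e : R) : 0 < s -> 0 < e ->
  exists m0 : nat, forall m, (m0 <= m)%N -> expR (c - m%:R * s) <= e.
Proof.
move=> s0 e0; exists (Num.bound `|(c - ln e) / s|) => m hm.
rewrite -[leRHS]lnK ?posrE // ler_expR lerBlDr -lerBlDl -ler_pdivrMr //.
apply: (le_trans (ler_norm _)); apply: (le_trans (ltW (archi_boundP (normr_ge0 _)))).
by rewrite ler_nat.
Qed.

End Chernoff.

Lemma leq_sum4 a b c e (m := (a + b + c + e).+1) :
  [/\ (a <= m)%N, (b <= m)%N, (c <= m)%N & (e < m)%N].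
Proof. by rewrite /m; split; lia. Qed.

(** Every tail supremum is 1. Values near 1 at arbitrarily large indices are enough, so good codes
    are needed only at lengths [m * n]. *)
Lemma limn_esup_eq1 (R : realType) (u : nat -> \bar R) :
  (forall n, (u n <= 1)%E) ->
  (forall e : R, 0 < e -> forall n0, exists2 n, (n0 <= n)%N & ((1 - e)%:E <= u n)%E) ->
  limn_esup u = 1%E.
Proof.
move=> u1 uN; rewrite limn_esup_lim.
have -> : esups u = fun=> 1%E.
  apply/funext => n; apply/eqP; rewrite eq_le; apply/andP; split.
    by apply: ge_ereal_sup => _ [k _ <-].
  apply/lee_addgt0Pr => e e0.
  have [k nk hk] := uN e e0 n.
  rewrite -leeBlDr // -EFinB (le_trans hk) //.
  by apply: ereal_sup_ubound; exists k.
exact: lim_cst.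
Qed.

Section Achievability.
Variables (R : realType) (d : nat) (omega : R[i]) (P : 'F_d * 'F_d -> R).
Hypothesis d_prime : prime d.
Hypothesis omega_prim : d.-primitive_root omega.
Hypothesis P_ge0 : forall u, 0 <= P u.
Hypothesis P_sum1 : \sum_u P u = 1.
Local Notation C := (R[i]).

(** At rate 0 a maximal isotropic [M] with [perp M = M] gives a one-dimensional code on which every
    error is corrected. *)
Lemma capacity_ge0 : (0 <= capacity omega P)%E.
Proof.
apply: ereal_sup_ubound; exists 0 => //; split => //.
apply: limn_esup_eq1 => [n|e e0 n0]; first by rewrite Fstar_le1 // mul0r.
exists n0 => //; rewrite mul0r; set n := n0.+1.
have g0 : zgroup ([set 0] : {set 'M['F_d]_(n, 2)}).
  by apply: zgroupI => [|x y]; rewrite !inE // => /eqP -> /eqP ->; rewrite subrr.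
have i0 : [set 0] \subset perp ([set 0] : {set 'M['F_d]_(n, 2)}).
  by rewrite finset.sub1set zgroup0 // perp_zgroup.
(* The weight is zero: the tower serves only to reach size [d ^ n]. *)
have [|M [gM iM _ cM _]] := isotropic_tower d_prime omega_prim (a := n) (w := fun=> (0 : R)) (fun=> lexx _) g0 i0.
  by rewrite cards1 mul1n.
have cM' : (#|M| * d ^ 0 = d ^ n)%N by rewrite cM cards1 mul1n muln1.
have eM : perp M = M.
  apply/esym/eqP; rewrite eqEcard iM /=.
  rewrite -(leq_pmul2l (zgroup_card_gt0 gM)) (card_perp d_prime omega_prim) // card_V //.
  by rewrite -cM' muln1.
have gp := perp_zgroup M.
have r_mem x : coset_rep (perp M) x - x \in perp M by exact: coset_rep_mem.
have r_const x y : x - y \in perp M -> coset_rep (perp M) x = coset_rep (perp M) y.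
  exact: coset_rep_const.
apply: le_trans (Fstar_ge_stabilizer d_prime omega_prim P_ge0 gM iM cM' r_mem r_const (lexx _)).
rewrite lee_fin (eq_bigl predT) ?Pn_sum1 ?lerBlDr ?lerDl ?ltW // => x.
by rewrite eM zgroup_subC //; have := r_mem x; rewrite eM => ->.
Qed.

Section Concatenation.
Variables (n k : nat) (L : {set 'M['F_d]_(n, 2)}).
Hypothesis n_gt0 : (0 < n)%N.
Hypothesis gL : zgroup L.
Hypothesis iL : L \subset perp L.
Hypothesis cardL : (#|L| * d ^ k = d ^ n)%N.
Local Notation W := ('M['F_d]_(n, 2)).
Local Notation p := (@Pn R d P n).
Local Notation q := (coset_prob P L).
Local Notation g := (coset_prob P (perp L)).
(** The entropy, with natural logarithms, of the coset modulo [L] of an error given its syndrome. *)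
Let h := \sum_w p w * (ln (g w) - ln (q w)).

Let p_ge0 : forall w, 0 <= p w. Proof. by move=> w; exact: Pn_ge0. Qed.

Lemma coset_prob_gt0 G w : zgroup G -> 0 < p w -> 0 < coset_prob P G w.
Proof. by move=> gG pw; apply: lt_le_trans (coset_prob_ge P_ge0 w gG). Qed.

Lemma cond_entropy_ge0 : 0 <= h.
Proof.
apply: sumr_ge0 => w _.
have [->|p0] := eqVneq (p w) 0; first by rewrite mul0r.
have pw : 0 < p w by rewrite lt_neqAle eq_sym p0 p_ge0.
rewrite mulr_ge0 // subr_ge0 ler_ln ?posrE ?coset_prob_gt0 ?perp_zgroup //.
rewrite /coset_prob [leLHS]big_mkcond [leRHS]big_mkcond; apply: ler_sum => l _.
case: ifP => [/(fintype.subsetP iL) -> //|_]; by case: ifP.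
Qed.

(** Chernoff bound: for an atypical error of positive probability the block sum of
    [ln g - ln q - tau0] is positive, so the exponential weight is at least 1; its expectation
    factors over the blocks. *)
Lemma atypical_prob m (t tau0 : R) : 0 <= t ->
  \sum_(x | ~~ typical P (block_set m L) (expR (m%:R * tau0)) x) Pn P x <=
  (\sum_w p w * expR (t * (ln (g w) - ln (q w) - tau0))) ^+ m.
Proof.
move=> t0.
have -> : (\sum_w p w * expR (t * (ln (g w) - ln (q w) - tau0))) ^+ m =
    \sum_(x : 'M['F_d]_(m * n, 2)) \prod_(j < m) (p (block j x) * expR (t * (ln (g (block j x)) - ln (q (block j x)) - tau0))).
  rewrite (sum_blocks (fun _ w => p w * expR (t * (ln (g w) - ln (q w) - tau0)))).
  by rewrite prodr_const card_ord.
rewrite [leLHS]big_mkcond; apply: ler_sum => x _.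
rewrite big_split /= -Pn_blocks.
have r0 : 0 <= \prod_j expR (t * (ln (g (block j x)) - ln (q (block j x)) - tau0)).
  by apply: prodr_ge0 => j _; exact: expR_ge0.
case: ifP => [|_]; last by rewrite mulr_ge0 ?Pn_ge0.
have [->|p0] := eqVneq (Pn P x) 0; first by rewrite mul0r.
rewrite /typical perp_block_set // !coset_prob_blocks -ltNge => lt.
have pj j : 0 < p (block j x).
  rewrite lt_neqAle p_ge0 andbT eq_sym; apply: contra_neq p0 => pj0.
  by rewrite Pn_blocks (bigD1 j) //= pj0 mul0r.
have gj j : 0 < g (block j x) by rewrite coset_prob_gt0 ?perp_zgroup.
have qj j : 0 < q (block j x) by rewrite coset_prob_gt0.
rewrite ler_peMr ?Pn_ge0 // -expR_sum -expR0 ler_expR -mulr_sumr mulr_ge0 //.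
rewrite sumrB sumr_const card_ord subr_ge0 -[tau0 *+ m]mulr_natl -ler_expR.
rewrite sumrB expRB expR_sum expR_sum.
rewrite (eq_bigr (fun j => g (block j x))) => [|j _]; last by rewrite lnK ?posrE.
rewrite (eq_bigr (fun j => q (block j x)) (F1 := fun j => expR (ln (q (block j x))))) => [|j _]; last by rewrite lnK ?posrE.
by rewrite ler_pdivlMr ?ltW // prodr_gt0.
Qed.

Lemma rate_achievable (r : R) : 0 <= r -> r * n%:R * ln d%:R < k%:R * ln d%:R - h ->
  (r%:E <= capacity omega P)%E.
Proof.
move=> r0 rh; apply: ereal_sup_ubound; exists r => //; split => //.
have ld : 0 < ln d%:R :> R by rewrite ln_gt0 // ltr1n prime_gt1.
have h0 := cond_entropy_ge0.
apply: limn_esup_eq1 => [m|e e0 N0]; first by rewrite Fstar_le1 // mulr_ge0.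
pose delta := k%:R * ln d%:R - h - r * n%:R * ln d%:R.
have de : 0 < delta by rewrite subr_gt0.
(* A third of the gap makes the Chernoff exponent positive; two thirds remain for the
   competitors. *)
pose tau0 := h + delta / 3.
have [|t t0 ht] := @chernoff_base R W p (fun w => ln (g w) - ln (q w) - tau0) p_ge0 (Pn_sum1 P_sum1 n).
  rewrite (eq_bigr (fun w => p w * (ln (g w) - ln (q w)) - p w * tau0)) => [|w _]; last by rewrite mulrBr.
  by rewrite sumrB -mulr_suml (Pn_sum1 P_sum1) mul1r -/h /tau0; lra.
set rho := \sum_w _ in ht.
have rho0 : 0 <= rho by apply: sumr_ge0 => w _; rewrite mulr_ge0 ?expR_ge0.
(* [m1] controls atypical errors, [m2] typical competitors, and [m3] leaves room for rounding the
   number of encoded qudits up to an integer. *)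
have [m1 hm1] := @expR_small R 0 (1 - rho) (e / 2) ltac:(lra) ltac:(lra).
have [m2 hm2] := @expR_small R (ln d%:R) (2 / 3 * delta) (e / 2) ltac:(lra) ltac:(lra).
have [m3 hm3] := @expR_small R 0 (k%:R - r * n%:R) (expR (-1)) ltac:(by rewrite subr_gt0 -(ltr_pM2r ld); lra) (expR_gt0 _).
pose m := (m1 + m2 + m3 + N0).+1.
have m_gt0 : (0 < m)%N by [].
have [/hm1 {}hm1 /hm2 {}hm2 /hm3 {}hm3 N0m] := leq_sum4 m1 m2 m3 N0; rewrite -/m in hm1 hm2 hm3 N0m.
rewrite ler_expR in hm3.
(* The sequence in [capacity] has length [n.+1] at index [n]. *)
exists (m * n).-1; first by rewrite -ltnS prednK ?muln_gt0 // (leq_trans N0m) ?leq_pmulr.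
rewrite prednK ?muln_gt0 //.
pose y := r * (m * n)%:R.
have y0 : 0 <= y by rewrite mulr_ge0.
(* An integer number of encoded qudits above the target [y]; it exceeds [y] by at most 1, which
   costs the term [ln d%:R] in the choice of [m2]. *)
pose K := (Num.trunc y).+1.
have /andP [Ky1 Ky2] := truncn_itv y0.
have Kk : (K <= m * k)%N.
  rewrite -(ler_nat R) /K -natr1 natrM.
  by move: Ky1; rewrite /y natrM; lra.
pose a := (m * k - K)%N.
have cM : (#|block_set m L| * d ^ (m * k) = d ^ (m * n))%N.
  by rewrite (card_block_set R) mulnC [(m * k)%N]mulnC expnM -expnMn mulnC cardL -expnM mulnC.
have aK : (a <= m * k)%N by rewrite leq_subr.
have yK : y <= (m * k - a)%:R by rewrite /a subKn // ltW.
have := Fstar_ge_random_coding d_prime omega_prim P_ge0 P_sum1 (block_set_zgroup m gL) (block_set_isotropic m gL iL) cM aK (expR_ge0 (m%:R * tau0)) yK.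
apply: le_trans; rewrite lee_fin lerD2l lerN2.
have -> : e = e / 2 + e / 2 by lra.
apply: lerD.
  apply: (le_trans (atypical_prob m tau0 t0)); apply: le_trans hm1.
  rewrite sub0r -mulrN expRM_natl lerXn2r ?nnegrE ?expR_ge0 //.
  by apply: le_trans (expR_ge1Dx _); rewrite -/rho opprB addrCA subrr addr0.
apply: le_trans hm2.
have -> : (d ^ a)%:R = expR (a%:R * ln d%:R) :> R.
  by rewrite natrX expRM_natl lnK // posrE ltr0n prime_gt0.
rewrite -expRB ler_expR /a natrB // natrM.
have K2 : K%:R <= r * (m%:R * n%:R) + 1 by rewrite /K -natr1 lerD2r -natrM.
have : K%:R * ln d%:R <= (r * (m%:R * n%:R) + 1) * ln d%:R by rewrite ler_wpM2r // ltW.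
rewrite /tau0 /delta mulrBl.
move: (K%:R * _) => X hX.
have := hX; nra.
Qed.

End Concatenation.

(** A nonzero vector of the code is a joint eigenvector for [tau], so the stabilizer projection can
    be formed from the given [tau]. *)
Lemma stabilizer_code_coh_info n (Cs : {vspace vec R (qidx d n)}) : stabilizer_code omega Cs ->
  exists (k : nat) (L : {set 'M['F_d]_(n, 2)}), [/\ zgroup L, L \subset perp L, (#|L| * d ^ k = d ^ n)%N &
   coh_info d (@chanK R d omega P n) ((\dim Cs)%:R^-1 *: orth_proj Cs) =
   k%:R - \sum_x Pn P x * (ln (coset_prob P (perp L) x) - ln (coset_prob P L x)) / ln d%:R].
Proof.
move=> [Lv [k [kn iso dimL [tau [CsP dimC]]]]].
pose L : {set 'M['F_d]_(n, 2)} := [set x | x \in Lv].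
have LE x : (x \in L) = (x \in Lv) by rewrite inE.
have gL : zgroup L by apply: zgroupI => [|x y]; rewrite !LE ?mem0v //; exact: rpredB.
have iL : L \subset perp L.
  by apply/fintype.subsetP => y; rewrite LE => yL; apply/perpP => x; rewrite LE => xL; exact: iso.
have cL : (#|L| = d ^ (n - k))%N.
  transitivity (#|'F_d| ^ \dim Lv)%N; last by rewrite card_Fp // dimL.
  by rewrite cardsE; exact: card_vspace.
have cLk : (#|L| * d ^ k = d ^ n)%N by rewrite cL -expnD subnK.
exists k, L; split => //.
have psi0 : vpick Cs != 0 by rewrite vpick0 -dimv_eq0 dimC -lt0n expn_gt0 prime_gt0.
have psie x : x \in L -> Nx omega x *m vpick Cs = tau x *: vpick Cs.
  by rewrite LE; have /CsP := memv_pick Cs; apply.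
pose Pi := stab_proj omega L tau.
have PiI : Pi *m Pi = Pi by apply: stab_proj_idem psie.
have PiA : adj Pi = Pi by apply: stab_proj_adj psie.
have PiE l : l \in L -> Nx omega l *m Pi = tau l *: Pi by apply: Nx_stab_proj psie l.
have PiO : is_orth_proj Cs Pi.
  split => //; split => v.
    by apply/CsP => x; rewrite -LE => xL; rewrite mulmxA PiE // -scalemxAl.
  by move=> /CsP hv; apply: (stab_proj_fix d_prime omega_prim gL psi0 psie) => x; rewrite LE; exact: hv.
have [QA [QC QF]] : is_orth_proj Cs (orth_proj Cs).
  by apply: (ClassicalEpsilon.epsilon_spec (inhabits (0 : op R (qidx d n))) (is_orth_proj Cs)); exists Pi.
have mxE0 (A B : op R (qidx d n)) : (forall v : vec R (qidx d n), A *m v = B *m v) -> A = B.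
  move=> e; apply/matrixP => i j; have := e (delta_mx j 0) => /matrixP/(_ i 0).
  by rewrite -!colE !mxE.
(* Both are self-adjoint and project onto [Cs], so each absorbs the other; taking adjoints
   identifies them. *)
have QP : orth_proj Cs = Pi.
  have e1 : orth_proj Cs *m Pi = Pi.
    by apply: mxE0 => v; rewrite -mulmxA QF // (PiO.2.1 v).
  have e2 : Pi *m orth_proj Cs = orth_proj Cs.
    by apply: mxE0 => v; rewrite -mulmxA (PiO.2.2 _ (QC v)).
  by rewrite -QA -e2 hadjM QA PiA e1.
rewrite QP dimC.
have tr y := stab_proj_tr d_prime omega_prim gL psi0 psie y.
apply: (coh_info_stabilizer d_prime omega_prim P_ge0 P_sum1 gL PiI PiA PiE).
- by move=> x xL; apply: (tau_conj d_prime omega_prim psi0 psie).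
- by move=> y; apply: stab_proj_comm.
- by move=> y; apply: (stab_proj_orth d_prime omega_prim gL iL psi0 psie).
- by move=> y /negPf yL; rewrite tr yL mul0r.
rewrite (idem_mxtrace PiI); congr (_%:R); apply/eqP.
rewrite -(eqn_pmul2r (zgroup_card_gt0 gL)) [X in _ == X]mulnC cLk.
by apply/eqP; apply: stab_proj_rank psie.
Qed.

End Achievability.

Theorem theorem1 (R : realType) (d : nat) (omega : R[i]) (P : 'F_d * 'F_d -> R) :
  prime d ->
  d.-primitive_root omega ->
  (forall u, 0 <= P u) ->
  \sum_(u : 'F_d * 'F_d) P u = 1 ->
  (ereal_sup [set ereal_sup
      [set (coh_info d (@chanK R d omega P n)
              ((\dim Cs)%:R^-1 *: orth_proj Cs) / n%:R)%:E
       | Cs in [set Cs : {vspace vec R (qidx d n)} | stabilizer_code omega Cs]]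
     | n in [set n : nat | (0 < n)%N]]
   <= capacity omega P)%E.
Proof.
move=> d_prime omega_prim P_ge0 P_sum1.
apply: ge_ereal_sup => _ [n n_gt0 <-]; apply: ge_ereal_sup => _ [Cs CsS <-].
have [k [L [gL iL cL ->]]] := stabilizer_code_coh_info d_prime omega_prim P_ge0 P_sum1 CsS.
have c0 := capacity_ge0 d_prime omega_prim P_ge0 P_sum1.
apply/lee_addgt0Pr => e e0; rewrite -leeBlDr // -EFinB.
(* The capacity ranges over nonnegative rates only; a negative [r] is covered by its
   nonnegativity. *)
set r := _ - e; have [r0|r0] := ltP r 0.
  by apply: le_trans c0; rewrite lee_fin ltW.
apply: (rate_achievable d_prime omega_prim P_ge0 P_sum1 n_gt0 gL iL cL r0).
have ld : 0 < ln d%:R :> R by rewrite ln_gt0 // ltr1n prime_gt1.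
have n0 : 0 < n%:R :> R by rewrite ltr0n.
rewrite /r -mulr_suml; set h := \sum_x _.
have -> : ((k%:R - h / ln d%:R) / n%:R - e) * n%:R * ln d%:R = k%:R * ln d%:R - h - e * n%:R * ln d%:R.
  by field; rewrite !gt_eqF.
by rewrite ltrBlDr ltrDl !mulr_gt0.
Qed.
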